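(* Fix $B\in\mathbb{H}_1$. Then the image of the map $\phi_{3,B}\colon A_{B} \to \mathbb{P}^2$, with homogeneous coordinates $[X_0,X_1,X_2]$ on $\mathbb{P}^2$, is the cubic $$X_0X_2^2 = -4X_1^3 + a(B)X_0X_1^2 + b(B)X_0^2X_1 + c(B)X_0^3.$$ Equivalently, for each $(u,B) \in (\mathbb{C}\times \mathbb{H}_1)\setminus \Theta_1$ the cumulants $\kappa_j=\kappa_j[X_{(u,B)}]$ satisfy $$\kappa_3^2 = -4\kappa_2^3 + a(B)\kappa_2^2 + b(B)\kappa_2 + c(B).$$
   Context: Notation: $\mathbf{e}(x)=e^{2\pi x}$. $\mathbb{H}_1=\{B\in\mathbb{C}:\operatorname{Re}B>0\}$, $\theta\colon\mathbb{C}\times\mathbb{H}_1\to\mathbb{C}$, $\theta(u,B)=\sum_{n\in\mathbb{Z}}\mathbf{e}(-\frac12 Bn^2+nu)$, $\Theta_1=\{(u,B):\theta(u,B)=0\}$. For $(u,B)\notin\Theta_1$, $X_{(u,B)}$ is a random variable on $\mathbb{Z}$ with the complex-valued probability distribution $p_\theta(n;u,B)=\frac{1}{\theta(u,B)}\mathbf{e}(-\frac12 Bn^2+nu)$ (complex discrete Gaussian). Its cumulants are $\kappa_j[X_{(u,B)}]=\frac{d^j}{dv^j}\log\mathbb{E}[e^{vX_{(u,B)}}]\big|_{v=0}$ for $j\ge1$, where $\mathbb{E}$ is summation against $p_\theta$. $A_B=\mathbb{C}/\{im+Bn: m,n\in\mathbb{Z}\}$ is the elliptic curve associated with $B$. For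 $j\geq 2$ the cumulant $\kappa_j$, as a function of $u$, is a meromorphic function on $A_B$. The map $\phi_{3,B}=[\theta^3,\theta^3\kappa_2,\theta^3\kappa_3]\colon A_B\to\mathbb{P}^2$ is everywhere defined and holomorphic. Writing $D_u^2(\log\theta)(u,B)=\frac{\partial^2}{\partial u^2}\log\theta(u,B)$ (i.e. $(\theta\,\partial_u^2\theta-(\partial_u\theta)^2)/\theta^2$), set $e_1=D_u^2(\log\theta)(0,B)$, $e_2=D_u^2(\log\theta)(\tfrac12 i,B)$, $e_3=D_u^2(\log\theta)(\tfrac{B}{2},B)$, and $$a(B)=\frac{1}{\pi^2}(e_1+e_2+e_3),\quad b(B)=-\frac{1}{4\pi^4}(e_1e_2+e_1e_3+e_2e_3),\quad c(B)=\frac{1}{16\pi^6}e_1e_2e_3.$$ *)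

(* Defs.v *)
From HB Require Import structures.
From mathcomp Require Import all_boot all_order all_algebra.
From mathcomp Require Import all_classical all_reals all_analysis.
From mathcomp Require Import ring_quotient complex.
From mathcomp.analysis.showcase Require summability.

Set Implicit Arguments.
Unset Strict Implicit.
Unset Printing Implicit Defensive.

Import Order.TTheory GRing.Theory Num.Theory.
Import numFieldNormedType.Exports.

Local Open Scope classical_set_scope.
Local Open Scope complex_scope.
Local Open Scope ring_scope.

(* The topology and the norm of R[i] are those of R[i] as a one-dimensional
   normed module over itself, so that [derive1n] is complex differentiation. *)
#[warnings="-redundant-canonical-projection,-HB.no-new-instance"]
HB.instance Definition _ (R : rcfType) :=
  PseudoPointedMetric.copy R[i] (R[i]^o).
#[warnings="-redundant-canonical-projection,-HB.no-new-instance"]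
HB.instance Definition _ (R : rcfType) := NormedModule.copy R[i] (R[i]^o).

Section ComplexFunctions.
Variable R : realType.
Implicit Types z : R[i].

Definition cexp z : R[i] :=
  (expR (complex.Re z) * cos (complex.Im z)) +i* (expR (complex.Re z) * sin (complex.Im z)).

(* Principal branch, with imaginary part in ]-pi, pi]; the value 0 at z = 0
   is a dummy. *)
Definition clog z : R[i] :=
  xget 0 [set w | cexp w = z /\ - pi < complex.Im w <= pi].

(* e(z) = exp(2 pi z), without a factor i *)
Definition e2pi z : R[i] := cexp (2 * pi%:C * z).

(* Limit of the partial sums along the finite subsets of the integers. *)
Definition sumZ (f : int -> R[i]) : R[i] := summability.sum f.

End ComplexFunctions.

Section ComplexDiscreteGaussian.
Variable R : realType.
Implicit Types (u B : R[i]) (n : int) (j : nat).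

Definition theta_term u B n : R[i] :=
  e2pi (- (2^-1 * B * n%:~R ^+ 2) + n%:~R * u).

Definition theta u B : R[i] := sumZ (theta_term u B).

Definition ptheta u B n : R[i] := (theta u B)^-1 * theta_term u B n.

(* The expectation of g(X), for X distributed according to [ptheta u B]. *)
Definition gauss_expectation u B (g : int -> R[i]) : R[i] :=
  sumZ (fun n => g n * ptheta u B n).

(* Since E[e^{vX}] = 1 at v = 0, the principal logarithm is holomorphic there. *)
Definition cumulant j u B : R[i] :=
  derive1n j (fun v : R[i] =>
    clog (gauss_expectation u B (fun n => cexp (v * n%:~R)))) 0.

End ComplexDiscreteGaussian.

Section EllipticCurve.
Variables (R : realType) (B : R[i]).

Definition period_lattice : {pred R[i]} :=
  [pred z | `[< exists m n : int, z = 'i%C * m%:~R + B * n%:~R >]].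

Lemma period_lattice_zmod_closed : zmod_closed period_lattice.
Proof.
split; first by apply/asboolP; exists 0, 0; rewrite !mulr0 addr0.
move=> x y /asboolP[m [n ->]] /asboolP[m' [n' ->]].
apply/asboolP; exists (m - m'), (n - n').
by rewrite !rmorphB /= !mulrBr opprD addrACA.
Qed.

HB.instance Definition _ :=
  GRing.isZmodClosed.Build R[i] period_lattice period_lattice_zmod_closed.

Definition elliptic_curve : Type := Quotient.quot period_lattice.

End EllipticCurve.

Section CubicEmbedding.
Variable R : realType.
Implicit Types (u B : R[i]) (j : nat) (X : 'rV[R[i]]_3).

(* Points are lines through the origin of R[i]^3. *)
Definition P2 : Type := {L : {vspace 'rV[R[i]]_3} | \dim L == 1%N}.
Definition line_of (p : P2) : {vspace 'rV[R[i]]_3} := \val p.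

Definition Theta B : set R[i] := [set u | theta u B = 0].

(* [cumulant j u B] is defined only for u outside [Theta B]; on [Theta B] the
   function theta^3 kappa_j (j <= 3) is given by its continuous extension. *)
Definition theta3_cumulant j B u : R[i] :=
  let f w := theta w B ^+ 3 * cumulant j w B in
  if theta u B != 0 then f u else lim (f @ within (~` Theta B) (nbhs u)).

Definition phi3_coord B u : 'rV[R[i]]_3 :=
  \row_j [:: theta u B ^+ 3; theta3_cumulant 2 B u; theta3_cumulant 3 B u]`_j.

(* At most one phi satisfies this, the projection onto A_B being surjective;
   since points of [P2] have dimension 1, it includes that the three
   coordinates never vanish simultaneously. *)
Definition is_phi3 B (phi : elliptic_curve B -> P2) : Prop :=
  forall u, line_of (phi (\pi_(elliptic_curve B)%qT u)) = <[phi3_coord B u]>%VS.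

(* D_u^2 (log theta), without a choice of logarithm *)
Definition D2log_theta u B : R[i] :=
  let th w := theta w B in
  (th u * derive1n 2 th u - derive1 th u ^+ 2) / th u ^+ 2.

Definition e1 B := D2log_theta 0 B.
Definition e2 B := D2log_theta ('i%C / 2) B.
Definition e3 B := D2log_theta (B / 2) B.

Definition coef_a B : R[i] :=
  (pi%:C ^+ 2)^-1 * (e1 B + e2 B + e3 B).
Definition coef_b B : R[i] :=
  - (4 * pi%:C ^+ 4)^-1 * (e1 B * e2 B + e1 B * e3 B + e2 B * e3 B).
Definition coef_c B : R[i] :=
  (16 * pi%:C ^+ 6)^-1 * (e1 B * e2 B * e3 B).

Definition cubic_eq B X : Prop :=
  X 0 0 * X 0 2 ^+ 2 =
    - 4 * X 0 1 ^+ 3 + coef_a B * X 0 0 * X 0 1 ^+ 2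
    + coef_b B * X 0 0 ^+ 2 * X 0 1 + coef_c B * X 0 0 ^+ 3.

Definition cubic B : set P2 :=
  [set p | forall X, X \in line_of p -> cubic_eq B X].

End CubicEmbedding.

(* Main.v *)
(* Everything rests on the addition formula
     theta(u+v) theta(u-v) = A(u) A(v) + C(u) C(v),
   A(u) = theta(2u, 2B), C(u) = e(u - B/4) theta(2u - B, 2B), obtained by splitting
   the pairs (m, n) according to the parity of m + n. Put u0 = (i + B)/2, a zero of
   theta, N = theta theta'' - theta'^2 and M = theta^3 (N/theta^2)'. Since (A, C) is
   mapped by the translation by u0 to a multiple of (C, -A),
     A(u) C(v) - C(u) A(v) = e(-B/4 - v) theta(u+v+u0) theta(u-v-u0).
   Pluecker's relation between four such 2x2 determinants forces the zero u0, and
   then every zero of theta, to be simple. Both N and theta^2 are linear forms in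
   (A, C), so N(u) theta(v)^2 - N(v) theta(u)^2 is a multiple of that determinant:
   at the half periods v it factors N - e_j theta^2, and its derivative at u = v
   gives M in terms of theta(2u+u0), hence of the theta functions translated by the
   half periods. This yields M^2 = -4 prod_j (N - e_j theta^2) up to a constant,
   which is read off at u0. Finally the cumulants are N/theta^2 and M/theta^3 up to
   powers of 2 pi, and N/theta^2 takes every value y because otherwise
   theta^2/(N - y theta^2) would be a doubly periodic function violating the maximum
   principle; the sign of kappa_3 is changed by u -> -u. *)
Require Import Defs.
From mathcomp Require Import all_boot all_order all_algebra.
From mathcomp Require Import all_classical all_reals all_analysis.
From mathcomp Require Import ring_quotient complex.
From mathcomp Require Import finmap ring lra zify.
From mathcomp.analysis.showcase Require summability.

Set Implicit Arguments.
Unset Strict Implicit.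
Unset Printing Implicit Defensive.

Import Order.TTheory GRing.Theory Num.Theory.
Import numFieldNormedType.Exports.

Local Open Scope classical_set_scope.
Local Open Scope complex_scope.
Local Open Scope ring_scope.

(** * Unconditional sums *)

(** The determinant of [A] and [C] does the work that residues and Liouville's theorem do in the
    classical theory: identities between quasi-periodic functions are reduced to linear relations in
    the plane spanned by [A] and [C]. The analytic difficulty is to cancel theta from an identity at
    points where it may vanish. This needs every zero to have finite order, hence theta not to
    vanish identically in u, which is proved by doubling B. Simplicity of the zeros then makes theta
    nonzero at the half periods 0, i/2, B/2, so that the e_j are genuine quotients; it lets the
    constant -4 be read off at u0, where N = -theta'^2 and M = 2 theta'^3; and it keeps the three
    coordinates from vanishing together. With kappa_2 = N / (2 pi theta)^2 and kappa_3 = M / (2 pi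
    theta)^3 the factored identity becomes kappa_3^2 = -4 prod_j (kappa_2 - e_j / (2 pi)^2), and
    expanding it gives a, b, c. The identities are derived over an abstract closed field from a list
    of functional equations and instantiated with the theta series afterwards. *)

Section FiniteSubsetSums.
Variables (K : numFieldType) (V : normedModType K).
Local Open Scope fset_scope.
Local Open Scope ring_scope.
#[local] Existing Instance summability.totally_filter.

(** Relational form of [summability.sum]: existence and value of a sum are asserted together. *)
Definition has_sum (I : choiceType) (x : I -> V) (s : V) :=
  (fun A : {fset I} => \sum_(i <- A) x i) @ summability.totally --> s.

Lemma has_sumP (I : choiceType) (x : I -> V) (s : V) :
  has_sum x s <-> (forall e : K, 0 < e -> exists A : {fset I},
    forall B, A `<=` B -> `|s - \sum_(i <- B) x i| < e).
Proof.
rewrite /has_sum cvgrPdist_lt; split=> h e /h.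
  by move=> [A _ hA]; exists A => B /hA.
by move=> [A hA]; exists A.
Qed.

Lemma sum_has_sum (I : choiceType) (x : I -> V) s :
  has_sum x s -> summability.sum x = s.
Proof.
move=> xs; rewrite /summability.sum; apply: norm_cvg_lim.
suff -> : summability.partial_sum x = (fun A : {fset I} => \sum_(i <- A) x i) by [].
by apply/funext => A; rewrite /summability.partial_sum big_seq_fsetE.
Qed.

Lemma has_sum_unique (I : choiceType) (x : I -> V) s t :
  has_sum x s -> has_sum x t -> s = t.
Proof. by move=> /sum_has_sum <- /sum_has_sum <-. Qed.

Lemma has_sumD (I : choiceType) (x y : I -> V) s t :
  has_sum x s -> has_sum y t -> has_sum (fun i => x i + y i) (s + t).
Proof.
move=> xs yt; rewrite /has_sum.
under eq_cvg do rewrite big_split /=.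
exact: cvgD.
Qed.

Lemma has_sumZ (I : choiceType) (x : I -> V) s c :
  has_sum x s -> has_sum (fun i => c *: x i) (c *: s).
Proof.
move=> xs; rewrite /has_sum.
under eq_cvg do rewrite -scaler_sumr.
exact: cvgZl_tmp.
Qed.

Lemma has_sumN (I : choiceType) (x : I -> V) s :
  has_sum x s -> has_sum (fun i => - x i) (- s).
Proof.
move=> xs; rewrite -scaleN1r (_ : (fun i => _) = (fun i => -1 *: x i)).
  exact: has_sumZ.
by apply/funext => i; rewrite scaleN1r.
Qed.

Lemma has_sumB (I : choiceType) (x y : I -> V) s t :
  has_sum x s -> has_sum y t -> has_sum (fun i => x i - y i) (s - t).
Proof. by move=> xs yt; apply: has_sumD => //; apply: has_sumN. Qed.

(** Reindexing along an injection [e] whose image contains the support of [y]; [j] lies in the image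
    exactly when [e (g j) = j]. This covers bijections as well as the splitting of a family into
    subfamilies. *)
Lemma has_sum_inj (I J : choiceType) (e : I -> J) (g : J -> I)
    (x : I -> V) (y : J -> V) s : cancel e g ->
    (forall i, y (e i) = x i) -> (forall j, e (g j) <> j -> y j = 0) ->
  has_sum x s -> has_sum y s.
Proof.
move=> eK yx y0 /has_sumP xs; apply/has_sumP => eps /xs[A hA].
exists [fset e i | i in A] => B AB.
have := hA [fset g j | j in B & e (g j) == j].
rewrite (_ : \sum_(i <- B) y i =
  \sum_(i <- [fset g j | j in B & e (g j) == j]) x i).
  apply; apply/fsubsetP => i iA; apply/imfsetP; exists (e i); last by rewrite eK.
  rewrite /= !inE eK eqxx andbT; apply: (fsubsetP AB).
  by apply/imfsetP; exists i.
rewrite (big_fsetID _ (fun j => e (g j) == j)) /=.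
rewrite [X in _ + X]big1_fset ?addr0; last first.
  by move=> j; rewrite !inE /= => /andP[_ /eqP/y0].
rewrite -big_fset_condE [RHS]big_imfset /=; last first.
  by move=> j k /andP[_ /eqP hj] /andP[_ /eqP hk] /(congr1 e); rewrite hj hk.
rewrite big_filter; apply: eq_bigr => j /eqP h.
by rewrite -[in LHS]h yx.
Qed.

Lemma has_sum_le (I : choiceType) (x : I -> V) s (M : K) :
  has_sum x s -> (forall A : {fset I}, \sum_(i <- A) `|x i| <= M) -> `|s| <= M.
Proof.
move=> /has_sumP xs hM; apply/ler_addgt0Pr => e /xs[A /(_ A (fsubset_refl _)) h].
rewrite -(subrK (\sum_(i <- A) x i) s) addrC (le_trans (ler_normD _ _))//.
by apply: lerD; [exact: le_trans (ler_norm_sum _ _ _) _ | exact: ltW].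
Qed.

End FiniteSubsetSums.

(** * Real families with bounded finite sums *)

Section NonnegativeSums.
Local Open Scope fset_scope.
Local Open Scope ring_scope.

Lemma ler_sum_fset (K : numDomainType) (I : choiceType) (A B : {fset I}) (x : I -> K) :
  (forall i, 0 <= x i) -> A `<=` B -> \sum_(i <- A) x i <= \sum_(i <- B) x i.
Proof.
move=> x0 AB; rewrite [leRHS](big_fsetID _ (fun i => i \in A)) /=.
rewrite (_ : [fset i in B | i \in A] = A) ?lerDl ?sumr_ge0//.
apply/fsetP => i; rewrite !inE /=; apply/andP/idP => [[]//|iA].
by split=> //; apply: (fsubsetP AB).
Qed.

Lemma has_sum_ge0 (R : realType) (I : choiceType) (x : I -> R) M :
    (forall i, 0 <= x i) -> (forall A : {fset I}, \sum_(i <- A) x i <= M) ->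
  exists s, has_sum x s.
Proof.
move=> x0 hM; pose E := [set \sum_(i <- A) x i | A in [set: {fset I}]].
have hE : has_sup E.
  split; first by exists (\sum_(i <- fset0) x i); exists fset0.
  by exists M => _ [A _ <-].
exists (sup E); apply/has_sumP => e e0.
have [_ [A _ <-] hA] := sup_adherent e0 hE.
exists A => B AB; have := ler_sum_fset x0 AB.
have : \sum_(i <- B) x i <= sup E by apply: sup_upper_bound => //; exists B.
by move=> h1 h2; rewrite ger0_norm; lra.
Qed.

(** A real family is the difference of the nonnegative families x + |x| and |x|. *)
Lemma has_sum_real (R : realType) (I : choiceType) (x : I -> R) M :
    (forall A : {fset I}, \sum_(i <- A) `|x i| <= M) -> exists s, has_sum x s.
Proof.
move=> hM.
have [s hs] := has_sum_ge0 (fun i => normr_ge0 (x i)) hM.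
have [||t ht] := @has_sum_ge0 R I (fun i => x i + `|x i|) (M + M).
- by move=> i; rewrite -lerBlDr sub0r lerNl -normrN ler_norm.
- move=> A; rewrite big_split /= lerD// (le_trans _ (hM A))//.
  by apply: ler_sum => i _; exact: ler_norm.
exists (t - s); have -> : x = (fun i => x i + `|x i| - `|x i|).
  by apply/funext => i; rewrite addrK.
exact: has_sumB.
Qed.

End NonnegativeSums.

(** * Absolutely summable complex families and their products *)

Section ComplexSums.
Variable R : realType.
Local Open Scope fset_scope.
Local Open Scope ring_scope.
Local Notation C := R[i].

Lemma has_sumRC (I : choiceType) (x : I -> R) s :
  has_sum x s -> has_sum (fun i => (x i)%:C : C) s%:C.
Proof.
move=> /has_sumP xs; apply/has_sumP => e; rewrite ltcE /= => /andP[/eqP e1 e0].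
have [A hA] := xs _ e0; exists A => B /hA.
rewrite -rmorph_sum -rmorphB /= normc_def /= expr0n addr0 sqrtr_sqr.
by rewrite ltcE /= e1 eqxx.
Qed.

Lemma lec_Re (x y : C) : x <= y -> complex.Re x <= complex.Re y.
Proof. by rewrite lecE => /andP[]. Qed.

Lemma normc_ge_Im (z : C) : `|complex.Im z|%:C <= `|z|.
Proof.
by rewrite normc_def lecR -sqrtr_sqr ler_sqrt ?addr_ge0 ?sqr_ge0 ?lerDr ?sqr_ge0.
Qed.

Lemma has_sumMl (I : choiceType) (x : I -> C) s c :
  has_sum x s -> has_sum (fun i => c * x i) (c * s).
Proof. by move=> xs; exact: has_sumZ. Qed.

Lemma has_sumDC (I : choiceType) (x y : I -> C) s t :
  has_sum x s -> has_sum y t -> has_sum (fun i => x i + y i) (s + t).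
Proof. exact: has_sumD. Qed.

Lemma has_sumBC (I : choiceType) (x y : I -> C) s t :
  has_sum x s -> has_sum y t -> has_sum (fun i => x i - y i) (s - t).
Proof. exact: has_sumB. Qed.

Lemma has_sum_injC (I J : choiceType) (e : I -> J) (g : J -> I)
    (x : I -> C) (y : J -> C) s : has_sum x s -> cancel e g ->
    (forall i, y (e i) = x i) -> (forall j, e (g j) <> j -> y j = 0) ->
  has_sum y s.
Proof. by move=> xs eK yx y0; apply: has_sum_inj eK yx y0 xs. Qed.

Lemma has_sum_complex (I : choiceType) (x : I -> C) M :
    (forall A : {fset I}, \sum_(i <- A) `|x i| <= M) -> exists s, has_sum x s.
Proof.
move=> hM.
have h (p : C -> R) : (forall z, `|p z|%:C <= `|z|) ->
    forall A : {fset I}, \sum_(i <- A) `|p (x i)| <= complex.Re M.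
  move=> hp A; rewrite -lecR rmorph_sum /=.
  apply: le_trans (_ : (complex.Re (\sum_(i <- A) `|x i|))%:C <= _).
    by rewrite RRe_real ?ger0_real ?sumr_ge0// ler_sum.
  by rewrite lecR; apply: lec_Re.
have [s hs] := has_sum_real (h _ (@normc_ge_Re R)).
have [t ht] := has_sum_real (h _ normc_ge_Im).
exists (s%:C + 'i%C * t%:C).
have -> : x = (fun i => (complex.Re (x i))%:C + 'i%C * (complex.Im (x i))%:C).
  by apply/funext => i; exact: complexE.
by apply: has_sumD; [|apply: has_sumMl]; apply: has_sumRC.
Qed.

Definition fset_prod (I J : choiceType) (A : {fset I}) (B : {fset J}) :
  {fset I * J} := [fset ((i, j) : (I * J)%type) | i in A, j in B].

Lemma sumr_prod_fset (K : pzRingType) (I J : choiceType) (x : I -> K) (y : J -> K)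
    (A : {fset I}) (B : {fset J}) :
  \sum_(p <- fset_prod A B) x p.1 * y p.2 =
  (\sum_(i <- A) x i) * (\sum_(j <- B) y j).
Proof.
rewrite mulr_suml; under [RHS]eq_bigr do rewrite mulr_sumr.
rewrite [in LHS](perm_big [seq (i, j) | i <- A, j <- B]) /=.
  by rewrite big_allpairs_dep.
apply: uniq_perm.
- exact: fset_uniq.
- by apply: allpairs_uniq => // -[? ?] [? ?].
move=> [i j]; apply/imfset2P/allpairsP => /= [[i' hi [j' hj ->]]|[[i' j'] /= [hi hj ->]]].
  by exists (i', j').
by exists i' => //; exists j'.
Qed.

Lemma fset_rect (I J : choiceType) (P : {fset I * J}) :
  P `<=` fset_prod [fset p.1 | p in P] [fset p.2 | p in P].
Proof.
apply/fsubsetP => -[i j] ijP; apply/imfset2P => /=.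
exists i; first by apply/imfsetP; exists (i, j).
by exists j => //; apply/imfsetP; exists (i, j).
Qed.

Lemma sum_norm_prod (I J : choiceType) (x : I -> C) (y : J -> C) M N :
    (forall A : {fset I}, \sum_(i <- A) `|x i| <= M) ->
    (forall A : {fset J}, \sum_(i <- A) `|y i| <= N) ->
  forall A : {fset I * J}, \sum_(p <- A) `|x p.1 * y p.2| <= M * N.
Proof.
move=> hM hN A; under eq_bigr do rewrite normrM.
apply: le_trans (ler_sum_fset _ (fset_rect A)) _.
  by move=> p; rewrite mulr_ge0.
rewrite (sumr_prod_fset (fun i => `|x i|) (fun j => `|y j|)).
by rewrite ler_pM ?sumr_ge0.
Qed.

(** The double family is absolutely bounded, so it has some sum [r]; [r] is compared with [s * t] on
    a rectangle large enough for all three sums. *)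
Lemma has_sumM (I J : choiceType) (x : I -> C) (y : J -> C) s t M N :
    (forall A : {fset I}, \sum_(i <- A) `|x i| <= M) ->
    (forall A : {fset J}, \sum_(i <- A) `|y i| <= N) ->
    has_sum x s -> has_sum y t ->
  has_sum (fun p : I * J => x p.1 * y p.2) (s * t).
Proof.
move=> hM hN xs yt.
have [r hr] := has_sum_complex (sum_norm_prod hM hN).
suff <- : r = s * t by [].
apply/eqP; rewrite -subr_eq0 -normr_le0; apply/ler_addgt0Pr => e e0.
have e20 : 0 < e / 2 by rewrite divr_gt0.
have M0 : 0 <= M by rewrite (le_trans _ (hM fset0))// big_seq_fset0.
have N0 : 0 <= N by rewrite (le_trans _ (hN fset0))// big_seq_fset0.
(* If both factors are known up to this quantity, the product is known up to M + N times it; the + 1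
   keeps the denominator positive. *)
have d0 : 0 < e / 4 / (M + N + 1) by rewrite !divr_gt0 ?ltr_wpDl ?addr_ge0.
have [P hP] := (has_sumP _ _).1 hr _ e20.
have [A hA] := (has_sumP _ _).1 xs _ d0.
have [B hB] := (has_sumP _ _).1 yt _ d0.
pose A' := A `|` [fset p.1 | p in P]; pose B' := B `|` [fset p.2 | p in P].
have {hP} := hP (fset_prod A' B').
rewrite sumr_prod_fset => hP.
have {hA} hA := hA A' (fsubsetUl _ _).
have {hB} hB := hB B' (fsubsetUl _ _).
have {}hP : `|r - (\sum_(i <- A') x i) * (\sum_(i <- B') y i)| < e / 2.
  apply: hP; apply: fsubset_trans (fset_rect P) _.
  apply/fsubsetP => p /imfset2P[i iP [j jP ->]]; apply/imfset2P.
  exists i; first by apply: (fsubsetP (fsubsetUr _ _)).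
  by exists j => //; apply: (fsubsetP (fsubsetUr _ _)).
set a := \sum_(i <- A') x i in hA hP; set b := \sum_(i <- B') y i in hB hP.
rewrite add0r (_ : r - s * t = (r - a * b) + (- (s - a) * b - s * (t - b))); last by ring.
rewrite (le_trans (ler_normD _ _))// [leRHS](_ : e = e / 2 + e / 2); last by field.
apply: lerD (ltW hP) _.
rewrite (le_trans (ler_normB _ _))// !normrM normrN.
have bN : `|b| <= N by apply: le_trans (ler_norm_sum _ _ _) (hN _).
have sM : `|s| <= M by apply: has_sum_le xs hM.
apply: le_trans (_ : e / 4 / (M + N + 1) * N + M * (e / 4 / (M + N + 1)) <= _).
  by apply: lerD; apply: ler_pM => //; exact: ltW.
have MN : 0 < M + N + 1 by rewrite ltr_wpDl ?addr_ge0.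
rewrite (_ : _ + _ = (e / 4) * ((M + N) / (M + N + 1))); last by field; rewrite gt_eqF.
rewrite [leRHS](_ : _ = e / 4 * 2); last by field.
apply: ler_pM.
- by rewrite divr_ge0 // ltW.
- by rewrite divr_ge0 ?addr_ge0.
- exact: lexx.
- rewrite ler_pdivrMr// (le_trans (_ : _ <= M + N + 1)) ?lerDl//.
  by rewrite ler_peMl ?ler1n// ltW.
Qed.

End ComplexSums.

(** * Complex exponential and derivative *)

Section ComplexExponential.
Variable R : realType.
Local Notation C := R[i].
Implicit Types (x y z : C) (t : R).

Lemma cexpD x y : cexp (x + y) = cexp x * cexp y.
Proof.
case: x y => [a b] [c d]; apply/eqP; rewrite eq_complex /= expRD cosD sinD.
by apply/andP; split; apply/eqP; ring.
Qed.

Lemma cexp0 : cexp (0 : C) = 1.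
Proof. by rewrite /cexp /= expR0 cos0 sin0 mulr1 mulr0. Qed.

Lemma norm_cexp z : `|cexp z| = (expR (complex.Re z))%:C.
Proof.
rewrite normc_def /= !exprMn -mulrDr cos2Dsin2 mulr1 sqrtr_sqr.
by rewrite ger0_norm ?expR_ge0.
Qed.

Lemma cexp_neq0 z : cexp z != 0.
Proof.
by rewrite -normr_eq0 norm_cexp eq_complex /= negb_and gt_eqF ?expR_gt0.
Qed.

Lemma cexpN z : cexp (- z) = (cexp z)^-1.
Proof.
by apply: (mulfI (cexp_neq0 z)); rewrite -cexpD subrr cexp0 divff ?cexp_neq0.
Qed.

Lemma normcC z : `|z| = (Normc.normc z)%:C.
Proof. by case: z. Qed.

Lemma ReB x y : complex.Re (x - y) = complex.Re x - complex.Re y.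
Proof. by case: x y => [? ?] [? ?]. Qed.

Lemma Re_sum (I : Type) (r : seq I) (F : I -> C) :
  complex.Re (\sum_(i <- r) F i) = \sum_(i <- r) complex.Re (F i).
Proof. by apply: big_morph => // -[? ?] [? ?]. Qed.

Lemma Re_le_normc z : complex.Re z <= Normc.normc z.
Proof.
by rewrite -lecR -normcC (le_trans _ (normc_ge_Re z))// lecR ler_norm.
Qed.

Lemma normc_ge0 z : 0 <= Normc.normc z.
Proof. by rewrite -lecR -normcC normr_ge0. Qed.

Definition cexp_taylor n z : C := \sum_(j < n) z ^+ j / j`!%:R.

(** Taylor remainder in t of Re (c e^(tz)). Real parts reduce the estimate to monotonicity of real
    functions, and the free coefficient [c] recovers the modulus at the end. *)
Let P n c z t := complex.Re (c * cexp (t%:C * z)) -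
  \sum_(j < n) complex.Re (c * z ^+ j) * t ^+ j / j`!%:R.

Lemma is_derive_monomial (k : R) n t :
  is_derive t 1 (fun x : R => k * x ^+ n.+1 / n.+1`!%:R) (k * t ^+ n / n`!%:R).
Proof.
rewrite (_ : (fun x : R => _) = (k / n.+1`!%:R) \*: (fun x : R => x ^+ n.+1)); last first.
  by apply/funext => x; rewrite mulrAC.
have dX : is_derive t 1 (fun x : R => x ^+ n.+1) (n.+1%:R * t ^+ n).
  rewrite (_ : (fun x : R => _) = (fun x : R => x) ^+ n.+1); last first.
    by apply/funext => x; rewrite fctE.
  apply: is_derive_eq (is_deriveX n.+1 (is_derive_id t 1)) _.
  by rewrite /GRing.scale /= mulr1.
apply: is_derive_eq (is_deriveZ _ dX) _.
rewrite /GRing.scale /= factS natrM.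
have h1 : n.+1%:R != 0 :> R by rewrite pnatr_eq0.
have h2 : n`!%:R != 0 :> R by rewrite pnatr_eq0 -lt0n fact_gt0.
by field; rewrite h2 addrC natr1 h1.
Qed.

Let dP c z t : is_derive t 1 (fun t => complex.Re (c * cexp (t%:C * z)))
  (complex.Re (c * z * cexp (t%:C * z))).
Proof.
case: c z => [c d] [x y]; rewrite /cexp /=.
rewrite (_ : (fun t => _) = (fun t => c * (expR (t * x) * cos (t * y)) -
    d * (expR (t * x) * sin (t * y)))); last first.
  by apply/funext => u; rewrite !mul0r subr0 addr0.
rewrite !mul0r subr0 addr0; apply: is_derive_eq.
rewrite /GRing.scale /=; ring.
Qed.

Let dS n c z t : is_derive t 1
  (fun t => \sum_(j < n.+1) complex.Re (c * z ^+ j) * t ^+ j / j`!%:R)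
  (\sum_(j < n) complex.Re (c * z * z ^+ j) * t ^+ j / j`!%:R).
Proof.
elim: n => [|n IH].
  rewrite big_ord0 (_ : (fun t => _) = cst (complex.Re c)); first exact: is_derive_cst.
  apply/funext => u; rewrite big_ord_recl big_ord0 /= expr0 mulr1 expr0 mulr1.
  by rewrite fact0 divr1 addr0.
rewrite big_ord_recr /=.
under eq_fun do rewrite big_ord_recr /=.
apply: is_deriveD; rewrite -[c * z * _]mulrA -exprS.
exact: is_derive_monomial.
Qed.

(* Quantifying over c makes the derivative in t of P (n+1) c equal to P n (c z). *)
Let bound n c z t : 0 <= t <= 1 ->
  P n c z t <= Normc.normc c * Normc.normc z ^+ n * expR (Normc.normc z) *
    (t ^+ n / n`!%:R).
Proof.
elim: n c t => [|n IH] c t /andP[t0 t1].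
  rewrite /P big_ord0 subr0 expr0 mulr1 fact0 divr1 mulr1.
  apply: le_trans (Re_le_normc _) _; rewrite Normc.normcM ler_wpM2l ?normc_ge0//.
  rewrite -lecR -normcC norm_cexp lecR ler_expR.

  have -> : complex.Re (t%:C * z) = t * complex.Re z.
    by case: z => x y /=; rewrite mul0r subr0.
  rewrite (le_trans (ler_norm _))// normrM ger0_norm// -[leRHS]mul1r.
  by rewrite ler_pM ?normr_ge0// -lecR -normcC normc_ge_Re.
pose a : R := Normc.normc c * Normc.normc z ^+ n.+1 * expR (Normc.normc z).
pose psi (u : R) : R := a * u ^+ n.+1 / n.+1`!%:R.
have dpsi (u : R) : is_derive u 1 psi (a * u ^+ n / n`!%:R) by exact: is_derive_monomial.
(* [f] vanishes at 0 and is nondecreasing on [0, 1] by the induction hypothesis for [c * z]. *)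
pose f (u : R) : R := psi u - P n.+1 c z u.
have df (u : R) : is_derive u 1 f (a * u ^+ n / n`!%:R - P n (c * z) z u).
  apply: is_deriveB; apply: is_deriveB; [exact: dP|exact: dS].
have f0 : f 0 = 0.
  rewrite /f /psi expr0n mulr0 mul0r sub0r /P mul0r cexp0 mulr1 big_ord_recl big1.
    by rewrite expr0 expr0 fact0 !mulr1 divr1 addr0 subrr oppr0.
  by move=> i _; rewrite expr0n /= mulr0 mul0r.
suff : f 0 <= f t.
  by rewrite f0 subr_ge0 => /le_trans; apply; rewrite /psi /a !mulrA.
apply: (@ger0_derive1_ndecr R f 0 1) => //.
- move=> u; rewrite in_itv /= => /andP[u0 u1].
  rewrite derive1E (@derive_val _ _ _ _ _ _ _ (df u)) subr_ge0.
  apply: le_trans (IH _ _ _) _; first by rewrite !ltW.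
  by rewrite /a Normc.normcM exprS !mulrA.
- apply: continuous_subspaceT => u.
  by apply/differentiable_continuous/derivable1_diffP; have [] := df u.
Qed.

Lemma cexp_taylor_le n z :
  `|cexp z - cexp_taylor n z| <= `|z| ^+ n / n`!%:R * (expR (Normc.normc z))%:C.
Proof.
set w := _ - _.
(* For c the conjugate of w, Re (c w) = |w|^2, while the bound carries a factor |w| that can be
   cancelled. *)
have := bound n (w^*%C) z (t := 1); rewrite ler01 lexx => /(_ isT).
rewrite /P rmorph1 mul1r.

have e (c : C) : complex.Re (c * cexp z) -
    \sum_(j < n) complex.Re (c * z ^+ j) * 1 ^+ j / j`!%:R = complex.Re (c * w).
  rewrite mulrBr mulr_sumr ReB Re_sum; congr (_ - _).
  apply: eq_bigr => j _; rewrite expr1n mulr1 mulrA.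
  have -> : (j`!%:R)^-1 = ((j`!%:R)^-1)%:C :> C by rewrite fmorphV rmorph_nat.
  by case: (c * z ^+ j) => a b; rewrite /= mulr0 subr0.
rewrite e {e} (_ : complex.Re (w^*%C * w) = Normc.normc w ^+ 2); last first.
  case: (w) => a b; rewrite /= sqr_sqrtr ?addr_ge0 ?sqr_ge0//.
  by rewrite mulNr opprK !expr2.
rewrite expr1n expr2 (_ : Normc.normc (w^*%C) = Normc.normc w); last first.
  by case: (w) => a b; rewrite /= sqrrN.
rewrite -!mulrA => h.
rewrite !normcC.
have -> : (Normc.normc z)%:C ^+ n * (n`!%:R^-1 * (expR (Normc.normc z))%:C) =
    (Normc.normc z ^+ n * (expR (Normc.normc z) * (1 / n`!%:R)))%:C.
  by rewrite !rmorphM rmorphXn /= fmorphV rmorph_nat /= mul1r [_^-1 * _]mulrC.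
rewrite lecR; have := normc_ge0 w; rewrite le_eqVlt => /orP[/eqP <-|w0].
  by rewrite !mulr_ge0 ?exprn_ge0 ?normc_ge0 ?expR_ge0 ?divr_ge0 ?ler0n.
by rewrite -(ler_pM2l w0).
Qed.

Lemma cexp_taylorS n z : cexp_taylor n.+1 z = cexp_taylor n z + z ^+ n / n`!%:R.
Proof. by rewrite /cexp_taylor big_ord_recr. Qed.

End ComplexExponential.

(** * Differentiation in one variable *)

Section Derivative.
Variable K : numFieldType.
Implicit Types (f g h : K -> K) (x y z a b c : K).

(* Caratheodory's form of differentiability: products, compositions, inverses and
   limits of difference quotients then reduce to continuity. *)
Definition cderiv f x a := exists g, [/\ \forall z \near x, f z = f x + g z * (z - x),
  {for x, continuous g} & g x = a].

Lemma near_cvg_eq (T : Type) (U : topologicalType) (F : set_system T) (f g : T -> U) (l : U) :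
  Filter F -> (\forall z \near F, f z = g z) -> g @ F --> l -> f @ F --> l.
Proof.
move=> FF fg; apply: cvg_trans; apply: near_eq_cvg.
near=> z; symmetry; near: z; exact: fg.
Unshelve. all: by end_near. Qed.

Lemma cderiv_continuous f x a : cderiv f x a -> {for x, continuous f}.
Proof.
move=> [g [fg gc ga]].
rewrite /prop_for /continuous_at. refine (@near_cvg_eq K K (nbhs x) f _ (f x) _ fg _).
rewrite -[X in _ --> X]addr0 -(mulr0 (g x)) -(subrr x).
apply: cvgD; first exact: cvg_cst.
by apply: cvgM => //; apply: cvgB; [exact: cvg_id|exact: cvg_cst].
Qed.

Lemma derive1_cderiv f x a : cderiv f x a -> derive1 f x = a.
Proof.
move=> [g [fg gc <-]]; apply: norm_cvg_lim.
have gsc : (g \o shift x) @ 0^' --> g x by exact/continuous_withinNshiftx.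
apply: near_cvg_eq gsc.
have H : \forall h \near 0^', f (h + x) = f x + g (h + x) * (h + x - x).
  apply: nbhs_dnbhs; have := (nbhs0P _ _).1 fg.
  by apply: filterS => h; rewrite addrC.
near=> h; have h0 : h != 0 by near: h; exact: nbhs_dnbhs_neq.
have -> : f (h + x) = f x + g (h + x) * (h + x - x) by near: h.
by rewrite addrK addrC addKr /GRing.scale /= mulrCA mulVf// mulr1.
Unshelve. all: by end_near. Qed.

Lemma cderiv_cst c x : cderiv (cst c) x 0.
Proof.
exists (cst 0); split; [|exact: cst_continuous|by []].
by near=> z; rewrite [cst 0 z]/= mul0r addr0.
Unshelve. all: by end_near. Qed.

Lemma cderiv_id x : cderiv id x 1.
Proof.
exists (cst 1); split; [|exact: cst_continuous|by []].
by near=> z; rewrite mul1r addrC subrK.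
Unshelve. all: by end_near. Qed.

Lemma cderivD f g x a b : cderiv f x a -> cderiv g x b ->
  cderiv (fun z => f z + g z) x (a + b).
Proof.
move=> [f' [ff fc fa]] [g' [gf gc ga]]; exists (fun z => f' z + g' z).
split; [|exact: (cvgD fc gc)|by rewrite fa ga].
near=> z; rewrite (near ff z)// 1?(near gf z)//; ring.
Unshelve. all: by end_near. Qed.

Lemma cderivM f g x a b : cderiv f x a -> cderiv g x b ->
  cderiv (fun z => f z * g z) x (a * g x + f x * b).
Proof.
move=> df dg; have := cderiv_continuous dg.
move: df dg => [f' [ff fc fa]] [g' [gf gc ga]] gC.
exists (fun z => f' z * g z + f x * g' z).
split; [|exact: (cvgD (cvgM fc gC) (cvgM (cvg_cst (f x)) gc))|by rewrite fa ga].
near=> z.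
have e1 : f z = f x + f' z * (z - x) by near: z.
have e2 : g z = g x + g' z * (z - x) by near: z.
rewrite e1 e2; ring.
Unshelve. all: by end_near. Qed.

Lemma cderiv_comp f g x a b : cderiv f x a -> cderiv g (f x) b ->
  cderiv (fun z => g (f z)) x (b * a).
Proof.
move=> df dg; have := cderiv_continuous df.
move: df dg => [f' [ff fc fa]] [g' [gf gc ga]] fC.
exists (fun z => g' (f z) * f' z); split; [| |by rewrite fa ga].
  have {}gf : \forall z \near x, g (f z) = g (f x) + g' (f z) * (f z - f x) by exact: (fC _ gf).
  near=> z; have e1 : f z = f x + f' z * (z - x) by near: z.
  rewrite (near gf z)// -mulrA; congr (_ + _ * _).
  by rewrite e1 addrAC subrr add0r.
exact: (cvgM (continuous_comp fC gc) fc).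
Unshelve. all: by end_near. Qed.

Lemma cderivV f x a : f x != 0 -> cderiv f x a ->
  cderiv (fun z => (f z)^-1) x (- (a / f x ^+ 2)).
Proof.
move=> fx0 df; have fC := cderiv_continuous df.
have nz : \forall z \near x, f z != 0 by exact: cvgr_neq0 fC fx0.
move: df => [f' [ff fc fa]].
exists (fun z => - (f' z * (f z)^-1 * (f x)^-1)); split; [| |by rewrite fa expr2 invfM mulrA].
  near=> z; have e1 : f z = f x + f' z * (z - x) by near: z.
  have z0 : f z != 0 by near: z.
  have -> : - (f' z / f z / f x) * (z - x) = - ((f z - f x) / f z / f x).
    by rewrite [in X in _ = - (X / _ / _)]e1; ring.
  by field; rewrite z0 fx0.
exact: (cvgN (cvgM (cvgM fc (cvgV fx0 fC)) (cvg_cst (f x)^-1))).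
Unshelve. all: by end_near. Qed.

Lemma cderiv_near f g x a : (\forall z \near x, f z = g z) -> cderiv g x a -> cderiv f x a.
Proof.
move=> fg [g' [gf gc ga]]; exists g'; split => //.
have fgx : f x = g x by exact: (nbhs_singleton fg).
near=> z; rewrite fgx -(near gf z)//; near: z; exact: fg.
Unshelve. all: by end_near. Qed.

(** Differentiates a continuous solution [h] of g(h(z)) = f(z). With [g] the exponential, it shows
    that a continuous logarithm of a holomorphic function is holomorphic. *)
Lemma cderiv_inv f g h x a b : {for x, continuous h} -> b != 0 ->
  (\forall z \near x, g (h z) = f z) -> cderiv f x a -> cderiv g (h x) b ->
  cderiv h x (a / b).
Proof.
move=> hC b0 ghf [f' [ff fc fa]] [g' [gf gc gb]].
have g0 : \forall z \near x, g' (h z) != 0.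
  have gh0 : (g' \o h) x != 0 by rewrite /= gb.
  have gc' : (g' \o h) z @[z --> x] --> (g' \o h) x by exact: continuous_comp.
  exact: cvgr_neq0 gc' gh0.
have gh : \forall z \near x, g (h z) = g (h x) + g' (h z) * (h z - h x) by exact: (hC _ gf).
exists (fun z => f' z / g' (h z)); split; last by rewrite fa gb.
  have fhx : g (h x) = f x by exact: (nbhs_singleton ghf).
  near=> z.
  have e1 : f z = f x + f' z * (z - x) by near: z.
  have e2 : g (h z) = f z by near: z.
  have e3 : g' (h z) != 0 by near: z.
  have e4 : g (h z) = g (h x) + g' (h z) * (h z - h x) by near: z.
  have e5 : g' (h z) * (h z - h x) = f' z * (z - x).
    by apply: (addrI (f x)); rewrite -e1 -e2 -fhx e4.
  by rewrite mulrAC -e5 [g' _ * _]mulrC mulfK// addrC subrK.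
have gx0 : g' (h x) != 0 by rewrite gb.
exact: (cvgM fc (cvgV gx0 (continuous_comp hC gc))).
Unshelve. all: by end_near. Qed.

Lemma near_dist x e : 0 < e -> \forall z \near x, `|z - x| < e.
Proof.
move=> e0; near=> z; rewrite distrC; near: z.
exact: cvgr_dist_lt.
Unshelve. all: by end_near. Qed.

Lemma near0_lt e : 0 < e -> \forall s \near (0 : K), `|s| < e.
Proof. by move=> /(near_dist 0); apply: filterS => s; rewrite subr0. Qed.

Lemma continuous_lip f x (k : K) : (\forall z \near x, `|f z - f x| <= k * `|z - x|) ->
  {for x, continuous f}.
Proof.
move=> h; apply: (@cvgrPdist_lt K K K (nbhs x) _ f (f x)).2 => e e0.
have k0 : 0 < `|k| + 1 by rewrite ltr_wpDl.
near=> z.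
have hz : `|f z - f x| <= k * `|z - x| by near: z.
rewrite distrC (le_lt_trans hz)//.
rewrite -[k * _]ger0_norm ?(le_trans _ hz)// normrM normr_id.
apply: (@le_lt_trans _ _ ((`|k| + 1) * `|z - x|)); first by rewrite ler_wpM2r// lerDl.
rewrite mulrC -ltr_pdivlMr//; near: z.
by apply: near_dist; rewrite divr_gt0.
Unshelve. all: by end_near. Qed.

(** A quadratic remainder makes the difference quotient, completed by the value [a] at [x],
    Lipschitz at [x]. *)
Lemma cderiv_of_le f x a (k : K) :
  (\forall z \near x, `|f z - f x - a * (z - x)| <= k * `|z - x| ^+ 2) ->
  cderiv f x a.
Proof.
move=> h; exists (fun z => if z == x then a else (f z - f x) / (z - x)).
split; last by rewrite eqxx.
  near=> z; case: eqP => [->|/eqP zx]; first by rewrite subrr mulr0 addr0.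
  by rewrite divfK ?subr_eq0// addrC subrK.
apply: (@continuous_lip _ _ k); near=> z; rewrite eqxx.
case: eqP => [->|/eqP zx]; first by rewrite !subrr normr0 mulr0.
have z0 : z - x != 0 by rewrite subr_eq0.
rewrite -(ler_pM2r (_ : 0 < `|z - x|)) ?normr_gt0// -normrM -mulrA -expr2.
rewrite mulrBl divfK//; near: z; exact: h.
Unshelve. all: by end_near. Qed.

End Derivative.

Section ComplexDerivative.
Variable R : realType.
Local Notation C := R[i].
Implicit Types (f g h : C -> C) (x y z a b c : C).

Lemma derive1_cderivC f x a : cderiv f x a -> derive1 f x = a.
Proof. exact: derive1_cderiv. Qed.

Lemma cderiv_cexp x : cderiv (@cexp R) x (cexp x).
Proof.
apply: (@cderiv_of_le _ _ _ _ (`|cexp x| * (expR 1)%:C)).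
near=> z.
have {1}-> : z = x + (z - x) by rewrite addrC subrK.
rewrite cexpD.
have -> : cexp x * cexp (z - x) - cexp x - cexp x * (z - x) =
   cexp x * (cexp (z - x) - cexp_taylor 2 (z - x)).
  by rewrite /cexp_taylor !big_ord_recl big_ord0 /= expr0 expr1 !divr1 addr0; ring.
rewrite normrM -mulrA ler_wpM2l// (le_trans (cexp_taylor_le _ _))//.
rewrite mulrC; apply: ler_pM.
- by rewrite lecR expR_ge0.
- by rewrite divr_ge0 ?exprn_ge0 ?ler0n.
- rewrite lecR ler_expR -lecR -normcC ltW//; near: z; exact: near_dist.
- by rewrite ler_pdivrMr ?ltr0n// ler_peMr ?exprn_ge0 ?ler1n.
Unshelve. all: by end_near. Qed.

End ComplexDerivative.

Lemma ler_div_fact (K : numFieldType) (a e e' : K) m :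
  0 <= a -> 0 <= e -> e <= e' -> a / m`!%:R * e <= a * e'.
Proof.
move=> a0 e0 ee'; have m1 : 1 <= m`!%:R :> K by rewrite ler1n fact_gt0.
have m0 : 0 < m`!%:R :> K by rewrite (lt_le_trans ltr01).
by apply: ler_pM => //; [rewrite divr_ge0// ltW|rewrite ler_pdivrMr// ler_peMr].
Qed.

Lemma le_geometric (R : archiRealFieldType) (x M : R) :
  (forall m, x <= 2 ^- m * M) -> x <= 0.
Proof.
move=> h; rewrite leNgt; apply/negP => x0.
have M0 : 0 < M by have := h 0%N; rewrite expr0 invr1 mul1r; apply: lt_le_trans.
have := upper_nthrootP (leqnn (Num.Def.archi_bound (M / x))).
rewrite ltr_pdivrMr// => hM; have := h (Num.Def.archi_bound (M / x)).
by rewrite mulrC ler_pdivlMr ?exprn_gt0// mulrC leNgt hM.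
Qed.

(** * The theta series, its derivatives and its Taylor expansion *)

Section ThetaSeries.
Variable R : realType.
Local Notation C := R[i].
Local Open Scope fset_scope.
Local Open Scope ring_scope.
Implicit Types (B u s z : C) (n : int) (k : nat).

Lemma in_fset_of_seq (T : choiceType) (r : seq T) x :
  (x \in [fset y in r]) = (x \in r).
Proof. by apply/idP/idP => [|h]; rewrite inE. Qed.

(** Two geometric series, over [Posz i] and over [Negz i], which is -(i + 1). *)
Lemma sum_expR_int : exists M : R, forall A : {fset int},
  \sum_(n <- A) expR (- (`|n|%N%:R)) <= M.
Proof.
pose q : R := expR (-1).
have q0 : 0 <= q by exact: expR_ge0.
have q1 : q < 1 by rewrite -expR0 ltr_expR; lra.
have qX (m : nat) : expR (- m%:R) = q ^+ m by rewrite -expRM_natl mulrN1.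
have geo N : \sum_(i <- iota 0 N) q ^+ i <= (1 - q)^-1.
  rewrite -[X in iota 0 X]subn0 -/(index_iota 0 N) big_mkord.
  have := subrX1 q N; rewrite -opprB -[q - 1]opprB mulNr => /oppr_inj.
  move=> /esym e; rewrite -[leRHS]mul1r ler_pdivlMr ?subr_gt0// mulrC e.
  by rewrite gerBl exprn_ge0.
exists ((1 - q)^-1 + (1 - q)^-1) => A.
have [N hN] : exists N, forall n, n \in A -> (`|n| < N)%N.
  exists (\max_(n <- A) `|n|%N).+1 => n nA; rewrite ltnS.
  exact: (@leq_bigmax_seq _ _ xpredT absz).
pose S := [seq Posz i | i <- iota 0 N] ++ [seq Negz i | i <- iota 0 N].
have AS : A `<=` [fset n in S].
  apply/fsubsetP => n nA; rewrite in_fset_of_seq mem_cat.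
  have := hN _ nA; case: n nA => m _ mN.
    by rewrite map_f// mem_iota.
  by rewrite orbC map_f// mem_iota /= add0n; exact: ltnW.
apply: le_trans (ler_sum_fset _ AS) _; first by move=> i; exact: expR_ge0.
rewrite (perm_big S) /=; last first.
  apply: uniq_perm; [exact: fset_uniq| |by move=> n; rewrite in_fset_of_seq].
  rewrite cat_uniq; apply/and3P; split.
  - by rewrite map_inj_uniq ?iota_uniq// => ? ? [].
  - by apply/hasPn => _ /mapP[i _ ->]; apply/mapP => -[].
  - by rewrite map_inj_uniq ?iota_uniq// => ? ? [].
rewrite big_cat !big_map /=; apply: lerD.
  by under eq_bigr do rewrite qX; exact: geo.
apply: le_trans (geo N); apply: ler_sum => i _.
by rewrite qX exprS ler_piMl ?exprn_ge0// ltW.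
Qed.

Lemma expc_ge0 (r : R) : 0 <= (expR r)%:C :> C.
Proof. by rewrite ler0c expR_ge0. Qed.

Lemma ReM_real (r : R) z : complex.Re (r%:C * z) = r * complex.Re z.
Proof. by case: z => a b; rewrite /= mul0r subr0. Qed.

Lemma ReD z s : complex.Re (z + s) = complex.Re z + complex.Re s.
Proof. by case: z s => [? ?] [? ?]. Qed.

(** The factor by which d/du multiplies the n-th term of theta. *)
Definition freq n : C := 2 * pi%:C * n%:~R.

Lemma norm_freq n : `|freq n| = (2 * pi * (`|n|%N%:R))%:C.
Proof.
rewrite /freq !normrM normr_nat -[n%:~R](rmorph_int (real_complex R)) /=.
rewrite !normc_def /= !expr0n !addr0 !sqrtr_sqr ger0_norm ?pi_ge0//.
rewrite !rmorphM /= rmorph_nat -intr_norm.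
by rewrite -abszE pmulrn.
Qed.

Lemma theta_termD u s B n :
  theta_term (u + s) B n = theta_term u B n * cexp (freq n * s).
Proof. by rewrite /theta_term /e2pi -cexpD /freq; congr cexp; ring. Qed.

Lemma norm_theta_term u B n : `|theta_term u B n| =
  (expR (2 * pi * (- (2^-1 * complex.Re B * n%:~R ^+ 2) + n%:~R * complex.Re u)))%:C.
Proof.
rewrite /theta_term /e2pi norm_cexp; congr (expR _)%:C.
have -> : 2 * pi%:C = (2 * pi)%:C :> C by rewrite rmorphM /= rmorph_nat.
have -> : - (2^-1 * B * n%:~R ^+ 2) + n%:~R * u =
    (- (2^-1 * n%:~R ^+ 2))%:C * B + (n%:~R)%:C * u.
  by rewrite rmorphN rmorphM rmorphXn fmorphV rmorph_nat /= !rmorph_int; ring.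
by rewrite ReM_real ReD !ReM_real; ring.
Qed.

(** By completing the square, Gaussian decay beats every linear exponent. The weight e^(r |n|) later
    absorbs powers of [freq n] and Taylor remainders of the exponential. *)
Lemma theta_term_bound u B (r : R) : 0 < complex.Re B -> exists M : C,
  forall A : {fset int},
  \sum_(n <- A) `|theta_term u B n| * (expR (r * (`|n|%N%:R)))%:C <= M.
Proof.
move=> B0; have [M hM] := sum_expR_int.
pose b := pi * complex.Re B.
have b0 : 0 < b by rewrite mulr_gt0 ?pi_gt0.
(* The summand 1 sets aside the summable factor e^(-|n|), and c^2 / (4 b) is the maximum of c m - b
   m^2. *)
pose c := 2 * pi * `|complex.Re u| + r + 1.
pose D := expR (c ^+ 2 / (4 * b)).
exists (D * M)%:C => A.
apply: le_trans (_ : (D * \sum_(n <- A) expR (- (`|n|%N%:R)))%:C <= _); last first.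
  by rewrite lecR ler_wpM2l ?expR_ge0.
rewrite mulr_sumr rmorph_sum; apply: ler_sum => n _.
rewrite norm_theta_term -rmorphM lecR /= -!expRD ler_expR.
set m : R := `|n|%N%:R.
have mE : m = `|n%:~R| by rewrite /m natr_absz intr_norm.
have n2 : (n%:~R : R) ^+ 2 = m ^+ 2.
  by rewrite mE real_normK// num_real.
have nm : (n%:~R : R) * complex.Re u <= m * `|complex.Re u|.
  by rewrite mE -normrM ler_norm.
have h : pi * (n%:~R * complex.Re u) <= pi * (m * `|complex.Re u|).
  by rewrite ler_wpM2l ?pi_ge0.
rewrite n2.
have sq : c * m - b * m ^+ 2 <= c ^+ 2 / (4 * b).
  rewrite ler_pdivlMr; last by rewrite pmulr_rgt0.
  have := sqr_ge0 (2 * b * m - c); nra.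
have -> : 2 * pi * (- (2^-1 * complex.Re B * m ^+ 2) + n%:~R * complex.Re u) + r * m =
  2 * (pi * (n%:~R * complex.Re u)) + r * m - b * m ^+ 2 by rewrite /b; field.
rewrite -/m; move: sq; rewrite /c => sq; nra.
Qed.

Lemma freq_theta_bound u B k (r : R) : 0 < complex.Re B -> exists M : C,
  forall A : {fset int},
  \sum_(n <- A) `|freq n ^+ k * theta_term u B n| * (expR (r * (`|n|%N%:R)))%:C <= M.
Proof.
move=> B0; have [M hM] := theta_term_bound u (k%:R * (2 * pi) + r) B0.
exists M => A; apply: le_trans (hM A); apply: ler_sum => n _.
rewrite normrM mulrAC [leRHS]mulrC ler_wpM2r// normrX norm_freq -rmorphXn -rmorphM lecR /=.
rewrite [in leRHS]mulrDl expRD ler_wpM2r ?expR_ge0//.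
rewrite -[k%:R * _ * _]mulrA expRM_natl lerXn2r ?nnegrE ?expR_ge0 ?mulr_ge0 ?pi_ge0//.
by rewrite (le_trans _ (expR_ge1Dx _))// lerDr.
Qed.

(** The k-th derivative of theta in u, defined by termwise differentiation; [cderiv_dtheta]
    justifies the name. *)
Definition dtheta B k u : C := sumZ (fun n => freq n ^+ k * theta_term u B n).

Lemma dtheta_norm_bound u B k : 0 < complex.Re B -> exists M : C,
  forall A : {fset int}, \sum_(n <- A) `|freq n ^+ k * theta_term u B n| <= M.
Proof.
move=> B0; have [M hM] := freq_theta_bound u k 0 B0.
exists M => A; apply: le_trans (hM A); apply: ler_sum => n _.
by rewrite mul0r expR0 mulr1.
Qed.

Lemma dtheta_has_sum u B k : 0 < complex.Re B ->
  has_sum (fun n => freq n ^+ k * theta_term u B n) (dtheta B k u).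
Proof.
move=> B0; have [M hM] := dtheta_norm_bound u k B0.
have [s hs] := has_sum_complex hM.
by rewrite /dtheta /sumZ (sum_has_sum hs).
Qed.

Global Arguments dtheta_has_sum u {B} k _.

Lemma dtheta0 u B : dtheta B 0 u = theta u B.
Proof. by rewrite /dtheta /theta; congr sumZ; apply/funext => n; rewrite mul1r. Qed.

Lemma theta_has_sum u B : 0 < complex.Re B -> has_sum (theta_term u B) (theta u B).
Proof.
move=> /(dtheta_has_sum u 0); rewrite dtheta0.
by under eq_fun do rewrite mul1r.
Qed.

Global Arguments theta_has_sum u {B} _.

(** The Taylor remainder of the series is the sum of the remainders of its terms. Both the local
    estimate in s and the estimate as m tends to infinity start from this identity. *)
Lemma dtheta_taylor_has_sum u B k s m : 0 < complex.Re B ->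
  has_sum (fun n => freq n ^+ k * theta_term u B n *
       (cexp (freq n * s) - cexp_taylor m (freq n * s)))
    (dtheta B k (u + s) - \sum_(j < m) dtheta B (k + j) u * s ^+ j / j`!%:R).
Proof.
move=> B0; elim: m => [|m IH].
  rewrite big_ord0 subr0 (_ : (fun n => _) =
      (fun n => freq n ^+ k * theta_term (u + s) B n)).
    exact: dtheta_has_sum.
  by apply/funext => n; rewrite /cexp_taylor big_ord0 subr0 theta_termD mulrA.
rewrite (_ : (fun n => _) = (fun n => freq n ^+ k * theta_term u B n *
    (cexp (freq n * s) - cexp_taylor m (freq n * s)) -
    s ^+ m / m`!%:R * (freq n ^+ (k + m) * theta_term u B n))); last first.
  apply/funext => n; rewrite cexp_taylorS exprD [(freq n * s) ^+ m]exprMn.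
  move: (freq n ^+ k) (freq n ^+ m) (s ^+ m) (m`!%:R^-1) => a b c d. ring.
have h := has_sumBC IH (has_sumMl (c := s ^+ m / m`!%:R) (dtheta_has_sum u (k + m) B0)).
rewrite big_ord_recr opprD addrA /=.
have -> : dtheta B (k + m) u * s ^+ m / m`!%:R = s ^+ m / m`!%:R * dtheta B (k + m) u.
  by rewrite -mulrA mulrC.
exact: h.
Qed.
Global Arguments dtheta_taylor_has_sum u {B} k s m _.

Lemma dtheta_taylor u B k m : 0 < complex.Re B -> exists M : C, forall s, `|s| <= 1 ->
  `|dtheta B k (u + s) - \sum_(j < m) dtheta B (k + j) u * s ^+ j / j`!%:R| <=
  M * `|s| ^+ m.
Proof.
(* For |s| <= 1 one has |freq n * s| <= 2 pi |n|, hence the weight e^(2 pi |n|). *)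
move=> B0; have [M hM] := freq_theta_bound u (k + m) (2 * pi) B0.
exists M => s s1; apply: (has_sum_le (dtheta_taylor_has_sum u k s m B0)) => A.
rewrite mulrC; apply: le_trans (_ : _ <= `|s| ^+ m * _) (ler_wpM2l _ (hM A)); last first.
  by rewrite exprn_ge0.
rewrite mulr_sumr; apply: ler_sum => n _.
rewrite normrM; apply: le_trans (ler_wpM2l _ (cexp_taylor_le _ _)) _; first by [].
rewrite (normrM (freq n)) !(normrM (freq n ^+ _)) !(normrX _ (freq n)) exprD.
rewrite (exprMn m `|freq n|).
have t0 := normr_ge0 (theta_term u B n); have f0 := normr_ge0 (freq n).
set t := `|theta_term u B n| in t0 *; set f := `|freq n| in f0 *.
have E : (expR (Normc.normc (freq n * s)))%:C <= (expR (2 * pi * (`|n|%N%:R)))%:C :> C.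
  rewrite lecR ler_expR -lecR -normcC normrM norm_freq ler_piMr//.
  by rewrite ler0c !mulr_ge0 ?pi_ge0.
rewrite [leRHS](_ : _ = (f ^+ k * t) *
  ((f ^+ m * `|s| ^+ m) * (expR (2 * pi * (`|n|%N%:R)))%:C)); last by ring.
apply: ler_wpM2l; first by rewrite mulr_ge0 ?exprn_ge0.
have fs0 : 0 <= f ^+ m * `|s| ^+ m by rewrite mulr_ge0 ?exprn_ge0.
exact: (ler_div_fact m fs0 (expc_ge0 _) E).
Qed.

Lemma cderiv_dtheta u B k : 0 < complex.Re B -> cderiv (dtheta B k) u (dtheta B k.+1 u).
Proof.
move=> B0; have [M hM] := dtheta_taylor u k 2 B0.
apply: (@cderiv_of_le _ _ _ _ M); near=> z.
have := hM (z - u); rewrite [u + _]addrC subrK !big_ord_recl big_ord0 /= expr0 expr1.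
rewrite !divr1 addr0 mulr1 addn0 addn1 opprD addrA; apply.
by rewrite ltW//; near: z; exact: near_dist.
Unshelve. all: by end_near. Qed.

Lemma exp_fact_le (x : R) k : 0 <= x -> x ^+ k / k`!%:R <= expR x.
Proof.
move=> x0; case: k => [|k]; first by rewrite fact0 divr1 expr0 -expR0 ler_expR.
by apply: le_trans (expR_ge1Dxn k x0); rewrite lerDr.
Qed.

(* Bounding x^m/m! by 2^-m exp(2x), the m-th Taylor remainder of the series is
   O(2^-m). *)
Lemma dtheta_flat u B : 0 < complex.Re B -> (forall k, dtheta B k u = 0) ->
  forall s, theta (u + s) B = 0.
Proof.
move=> B0 flat s; set r := Normc.normc s.
have r0 : 0 <= r by exact: normc_ge0.
(* With x = |freq n * s| = 2 pi r |n|, the exponent 3 x consists of 2 x for x^m / m! and x for the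
   exponential in the remainder bound. *)
have [M hM] := theta_term_bound u (3 * (2 * pi * r)) B0.
have M0 : 0 <= M by rewrite (le_trans _ (hM fset0))// big_seq_fset0.
have bound m : `|theta (u + s) B| <= 2 ^- m * M.
  have := dtheta_taylor_has_sum u 0 s m B0.
  rewrite dtheta0 big1 ?subr0; last by move=> j _; rewrite flat !mul0r.
  move=> /has_sum_le; apply => A.
  apply: le_trans (ler_wpM2l _ (hM A)); last by rewrite invr_ge0 exprn_ge0.
  rewrite mulr_sumr; apply: ler_sum => n _; rewrite expr0 mul1r normrM mulrCA.
  rewrite ler_wpM2l// (le_trans (cexp_taylor_le _ _))//.
  set x := Normc.normc (freq n * s).
  have xE : x = 2 * pi * r * `|n|%N%:R.
    by apply: (@complexI R); rewrite -normcC normrM norm_freq normcC -rmorphM mulrAC.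
  have x0 : 0 <= x by exact: normc_ge0.
  rewrite normcC -/x.
  have -> : x%:C ^+ m / m`!%:R = (x ^+ m / m`!%:R)%:C.
    by rewrite rmorphM rmorphXn fmorphV rmorph_nat.
  have -> : 2 ^- m = (2 ^- m)%:C :> C by rewrite fmorphV rmorphXn rmorph_nat.
  rewrite -!rmorphM lecR /= (_ : 3 * _ * _ = 2 * x + x); last by rewrite xE; ring.
  rewrite expRD mulrA ler_wpM2r ?expR_ge0//.
  rewrite [leRHS]mulrC ler_pdivlMr ?exprn_gt0// mulrAC -exprMn [x * 2]mulrC.
  by apply: exp_fact_le; rewrite mulr_ge0.
have bR m : Normc.normc (theta (u + s) B) <= 2 ^- m * complex.Re M.
  have -> : 2 ^- m * complex.Re M = complex.Re ((2 ^- m)%:C * M) by rewrite ReM_real.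
  have := lec_Re (bound m); rewrite normcC fmorphV rmorphXn rmorph_nat.
  exact.
have := le_geometric bR.
by rewrite -lecR -normcC normr_le0 => /eqP.
Qed.

(** Zeros have finite order, since by [dtheta_flat] theta would otherwise vanish identically. [k] is
    the first derivative that is nonzero at [p], possibly 0, and Taylor's formula one order further
    makes the quotient by s^k continuous. *)
Lemma theta_order B p : 0 < complex.Re B -> (exists u, theta u B != 0) ->
  exists k g, [/\ forall s, theta (p + s) B = s ^+ k * g s,
    {for 0, continuous g} & g 0 != 0].
Proof.
move=> B0 [u thu].
have /existsNP[k0 hk0] : ~ forall k, dtheta B k p = 0.
  move=> flat; have := dtheta_flat B0 flat (u - p).
  by rewrite addrC subrK => /eqP; rewrite (negPf thu).
have ex : exists k, dtheta B k p != 0 by exists k0; apply/eqP.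
case: (ex_minnP ex) => k hk kmin.
pose g s := if s == 0 then dtheta B k p / k`!%:R else theta (p + s) B / s ^+ k.
have gE s : theta (p + s) B = s ^+ k * g s.
  rewrite /g; case: eqP => [->|/eqP s0]; last by rewrite mulrC divfK ?expf_neq0.
  rewrite addr0 -dtheta0; case: k hk kmin {g} => [|k] hk kmin.
    by rewrite expr0 mul1r fact0 divr1.
  rewrite expr0n mul0r; apply/eqP/negPn/negP => /kmin; by rewrite ltn0.
exists k, g; split => //; last first.
  by rewrite /g eqxx mulf_neq0 ?invr_eq0 ?pnatr_eq0 -?lt0n ?fact_gt0.
have [M hM] := dtheta_taylor p 0 k.+1 B0.
apply: (@continuous_lip _ _ _ M); near=> s.
rewrite {2}/g eqxx subr0 /g; case: eqP => [->|/eqP s0].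
  by rewrite subrr normr0 mulr0.
have := hM s; rewrite dtheta0 big_ord_recr big1 /=; last first.
  move=> i _; rewrite (_ : dtheta B (0 + i) p = 0) ?mul0r//.
  apply/eqP/negPn/negP => /kmin; by rewrite leqNgt add0n ltn_ord.
rewrite add0r add0n exprS => h.
have sk0 : s ^+ k != 0 by rewrite expf_neq0.
rewrite -(ler_pM2r (_ : 0 < `|s ^+ k|)) ?normr_gt0// -normrM mulrBl divfK//.
rewrite [_ / _ * _]mulrAC -[leRHS]mulrA (normrX k s); apply: h; apply: ltW.
by near: s; exact: (near0_lt ltr01).
Unshelve. all: by end_near. Qed.

End ThetaSeries.

(** * Theta identities *)

Section ThetaIdentities.
Variable R : realType.
Local Notation C := R[i].
Implicit Types (B u v x y : C) (n : int).

Lemma e2piD x y : e2pi (x + y) = e2pi x * e2pi y.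
Proof. by rewrite /e2pi mulrDr cexpD. Qed.

Lemma e2pi0 : e2pi (0 : C) = 1.
Proof. by rewrite /e2pi mulr0 cexp0. Qed.

Lemma e2pi_neq0 x : e2pi x != 0.
Proof. exact: cexp_neq0. Qed.

Lemma e2piN x : e2pi (- x) = (e2pi x)^-1.
Proof. by rewrite /e2pi mulrN cexpN. Qed.

Lemma e2pi_half_i : e2pi ('i%C / 2) = -1 :> C.
Proof.
rewrite /e2pi (_ : 2 * pi%:C * ('i%C / 2) = pi%:C * 'i%C); last first.
  by field.
apply/eqP; rewrite /cexp eq_complex /= !mul0r mulr0 subr0 mulr1 addr0 expR0 cospi sinpi.
by rewrite !mul1r oppr0 !eqxx.
Qed.

Lemma e2pi_i : e2pi 'i%C = 1 :> C.
Proof.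
have -> : 'i%C = 'i%C / 2 + 'i%C / 2 :> C by field.
by rewrite e2piD e2pi_half_i mulrNN mulr1.
Qed.

Lemma e2pi_intM n x : e2pi x = 1 -> e2pi (n%:~R * x) = 1.
Proof.
move=> x1.
have nat1 (m : nat) : e2pi (m%:R * x) = 1.
  elim: m => [|m IH]; first by rewrite mul0r e2pi0.
  by rewrite -natr1 mulrDl mul1r e2piD IH x1 mul1r.
case: n => m; first exact: nat1.
by rewrite NegzE mulrNz mulNr e2piN nat1 invr1.
Qed.

Lemma cderiv_e2pi x : cderiv (@e2pi R) x (2 * pi%:C * e2pi x).
Proof.
rewrite mulrC; apply: cderiv_comp (cderiv_cexp _).
have := cderivM (cderiv_cst (2 * pi%:C) x) (cderiv_id x).
by rewrite mul0r add0r mulr1.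
Qed.

Variables (B : C) (B0 : 0 < complex.Re B).

Lemma theta_even u : theta (- u) B = theta u B.
Proof.
have h : has_sum (theta_term (- u) B) (theta u B).
  apply: (has_sum_injC (e := fun n : int => - n) (g := fun n : int => - n) (theta_has_sum u B0)).
  - exact: opprK.
  - by move=> n; rewrite /theta_term; congr e2pi; rewrite rmorphN; ring.
  - by move=> n; rewrite opprK.
exact: has_sum_unique (theta_has_sum (- u) B0) h.
Qed.

Lemma theta_period u : theta (u + 'i%C) B = theta u B.
Proof.
rewrite /theta; congr sumZ; apply/funext => n.
rewrite /theta_term mulrDr addrA e2piD e2pi_intM ?mulr1//; exact: e2pi_i.
Qed.

Lemma theta_quasi_period u : theta (u + B) B = e2pi (B / 2 + u) * theta u B.
Proof.
have h : has_sum (theta_term (u + B) B) (e2pi (B / 2 + u) * theta u B).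
  have h0 := has_sumMl (c := e2pi (B / 2 + u)) (theta_has_sum u B0).
  apply: (has_sum_injC (e := fun n => n + 1) (g := fun n => n - 1) h0).
  - by move=> n; rewrite addrK.
  - move=> n; rewrite /theta_term -e2piD; congr e2pi; rewrite rmorphD /=.
    by field.
  - by move=> n; rewrite subrK.
exact: has_sum_unique (theta_has_sum _ B0) h.
Qed.

(** The quasi-period B carries (i - B)/2 to (i + B)/2 with the factor e(i/2) = -1, while evenness
    and the period i make the two values equal. *)
Lemma theta_zero : theta ('i%C / 2 + B / 2) B = 0.
Proof.
have := theta_quasi_period ('i%C / 2 - B / 2).
rewrite (_ : 'i%C / 2 - B / 2 + B = 'i%C / 2 + B / 2); last by field.
rewrite (_ : B / 2 + ('i%C / 2 - B / 2) = 'i%C / 2); last by field.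
rewrite e2pi_half_i mulN1r -(theta_even ('i%C / 2 - B / 2)) -(theta_period (- _)).
rewrite (_ : - ('i%C / 2 - B / 2) + 'i%C = 'i%C / 2 + B / 2); last by field.
by move=> /eqP; rewrite -addr_eq0 -mulr2n mulrn_eq0 /= => /eqP.
Qed.

(** [thetaA] and [thetaC] are the sums of e(-B m^2 + 2 m u) over m in Z and over m in Z + 1/2. *)
Definition thetaA B u : C := theta (2 * u) (2 * B).
Definition thetaC B u : C := e2pi (u - B / 4) * theta (2 * u - B) (2 * B).

End ThetaIdentities.

(** * The addition formula and translations by half periods *)

Section DoubleModulus.
Variable R : realType.
Local Notation C := R[i].
Variables (B : C) (B0 : 0 < complex.Re B).
Implicit Types (u v : C) (n : int).
Local Notation A := (thetaA B).
Local Notation C' := (thetaC B).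

Lemma Re2B_gt0 : 0 < complex.Re (2 * B).
Proof. by rewrite mulr_natl mulr2n ReD addr_gt0. Qed.
Let B20 := Re2B_gt0.

Lemma theta_addition u v :
  theta (u + v) B * theta (u - v) B = A u * A v + C' u * C' v.
Proof.
have [M hM] := dtheta_norm_bound (u + v) 0 B0.
have [N hN] := dtheta_norm_bound (u - v) 0 B0.
have [M1 hM1] := dtheta_norm_bound (2 * u) 0 B20.
have [N1 hN1] := dtheta_norm_bound (2 * v) 0 B20.
have [M2 hM2] := dtheta_norm_bound (2 * u - B) 0 B20.
have [N2 hN2] := dtheta_norm_bound (2 * v - B) 0 B20.
have hs := has_sumM hM hN (dtheta_has_sum _ 0 B0) (dtheta_has_sum _ 0 B0).
have he := has_sumM hM1 hN1 (dtheta_has_sum _ 0 B20) (dtheta_has_sum _ 0 B20).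
have ho := has_sumM hM2 hN2 (dtheta_has_sum _ 0 B20) (dtheta_has_sum _ 0 B20).
have {}ho := has_sumMl (c := e2pi (u - B / 4) * e2pi (v - B / 4)) ho.
rewrite !dtheta0 in hs he ho.
pose y (p : int * int) : C := freq R p.1 ^+ 0 * theta_term (u + v) B p.1 *
  (freq R p.2 ^+ 0 * theta_term (u - v) B p.2).
pose ev (p : int * int) := ((p.1 + p.2) %% 2)%Z == 0.
(* One left inverse for both parities: flooring recovers (k, l) from (k + l, k - l) and also from (k
   + l + 1, k - l). *)
pose g (p : int * int) : int * int := (((p.1 + p.2) %/ 2)%Z, ((p.1 - p.2) %/ 2)%Z).
have hye : has_sum (fun p => if ev p then y p else 0) (A u * A v).
  apply: (has_sum_injC (e := fun p => (p.1 + p.2, p.1 - p.2)) (g := g) he).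
  - by move=> [k l]; rewrite /g /=; congr pair; lia.
  - move=> [k l]; rewrite /ev /= (_ : _ == 0 = true); last by apply/eqP; lia.
    rewrite /y /= !mul1r /theta_term -!e2piD; congr e2pi.
    by rewrite rmorphB rmorphD /=; field.
  - move=> [m n]; rewrite /ev /g /=; case: eqP => // h []; congr pair; lia.
have hyo : has_sum (fun p => if ev p then 0 else y p) (C' u * C' v).
  rewrite /thetaC mulrACA.
  apply: (has_sum_injC (e := fun p => (p.1 + p.2 + 1, p.1 - p.2)) (g := g) ho).
  - by move=> [k l]; rewrite /g /=; congr pair; lia.
  - move=> [k l]; rewrite /ev /= (_ : _ == 0 = false); last by apply/eqP; lia.
    rewrite /y /= !mul1r /theta_term -!e2piD; congr e2pi.
    by rewrite rmorphB !rmorphD /=; field.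
  - move=> [m n]; rewrite /ev /g /=; case: eqP => // h []; congr pair; lia.
have ysum : (fun p => (if ev p then y p else 0) + (if ev p then 0 else y p)) = y.
  by apply/funext => p; case: (ev p); rewrite ?addr0 ?add0r.
have h := has_sumDC hye hyo; rewrite ysum in h.
exact: (has_sum_unique hs h).
Qed.

(** On the pair (A, C), translation by i/2 acts as diag(1, -1), and translation by B/2 exchanges the
    two entries up to a common exponential factor. *)
Lemma thetaA_half_i u : A (u + 'i%C / 2) = A u.
Proof.
rewrite /thetaA (_ : 2 * (u + 'i%C / 2) = 2 * u + 'i%C); last by field.
exact: theta_period.
Qed.

Lemma thetaC_half_i u : C' (u + 'i%C / 2) = - C' u.
Proof.
rewrite /thetaC (_ : 2 * (u + 'i%C / 2) - B = 2 * u - B + 'i%C); last by field.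
rewrite theta_period (_ : u + 'i%C / 2 - B / 4 = u - B / 4 + 'i%C / 2); last by ring.
by rewrite e2piD e2pi_half_i mulrN1 mulNr.
Qed.

Lemma thetaA_half_B u : A (u + B / 2) = e2pi (B / 4 + u) * C' u.
Proof.
rewrite /thetaA /thetaC mulrA -e2piD.
rewrite (_ : 2 * (u + B / 2) = 2 * u - B + 2 * B); last by field.
by rewrite theta_quasi_period//; congr (e2pi _ * _); field.
Qed.

Lemma thetaC_half_B u : C' (u + B / 2) = e2pi (B / 4 + u) * A u.
Proof.
rewrite /thetaA /thetaC (_ : 2 * (u + B / 2) - B = 2 * u); last by field.
by congr (e2pi _ * _); field.
Qed.

Lemma thetaC_even u : C' (- u) = C' u.
Proof.
rewrite /thetaC -theta_even// (_ : - (2 * - u - B) = 2 * u - B + 2 * B); last by ring.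
by rewrite theta_quasi_period// mulrA -e2piD; congr (e2pi _ * _); field.
Qed.

End DoubleModulus.

(** * Theta does not vanish identically *)

Section ThetaNonzero.
Variable R : realType.
Local Notation C := R[i].
Local Open Scope fset_scope.
Local Open Scope ring_scope.

(** The addition formula at (u/2, u/2) and at (u/2 + i/2, u/2) gives A^2 + C^2 = 0 and A^2 - C^2 = 0
    at u/2, and A(u/2) = theta(u, 2B). *)
Lemma theta_double_eq0 (B : C) : 0 < complex.Re B ->
  (forall u, theta u B = 0) -> forall u, theta u (2 * B) = 0.
Proof.
move=> B0 th0 u.
have h1 := theta_addition B0 (u / 2) (u / 2).
have h2 := theta_addition B0 (u / 2 + 'i%C / 2) (u / 2).
rewrite th0 mul0r in h1; rewrite th0 mul0r thetaA_half_i// thetaC_half_i in h2.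
have : thetaA B (u / 2) ^+ 2 *+ 2 = 0.
  by rewrite mulr2n -[RHS]addr0 {1}h1 h2; ring.
move/eqP; rewrite mulrn_eq0 /= expf_eq0 /= /thetaA mulrC divfK ?pnatr_eq0//.
by move/eqP.
Qed.

Lemma has_sum_delta : has_sum (fun n : int => if n == 0 then 1 else 0 : C) 1.
Proof.
apply/has_sumP => e e0; exists [fset 0] => D h.
have D0 : 0 \in D by apply: (fsubsetP h); rewrite in_fset1.
rewrite (big_fsetD1 0)//= big1_fset ?addr0 ?subrr ?normr0//.
by move=> n; rewrite in_fsetD1 => /andP[/negPf ->].
Qed.

(* If theta vanished identically for B, it would for 2^m B; but the terms n <> 0 of
   theta(0, 2^m B) tend to 0 in sum, and the term n = 0 is 1. *)
Lemma theta_neq0 (B : C) : 0 < complex.Re B -> exists u, theta u B != 0.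
Proof.
move=> B0; apply: contrapT => /forallNP nex.
have th0 m : 0 < complex.Re (2 ^+ m * B) /\ forall u, theta u (2 ^+ m * B) = 0.
  elim: m => [|m [IH1 IH2]].
    by rewrite mul1r; split => // u; apply/eqP/negPn/negP/nex.
  by rewrite exprS -mulrA; split; [exact: Re2B_gt0|exact: theta_double_eq0].
have [M hM] := sum_expR_int R.
(* Since M < 1 + L <= e^L, and [m] is such that pi Re(2^m B) >= 1 + L, the terms n <> 0 contribute
   at most M e^(-L) < 1. *)
pose L := `|M| + 1.
pose m := Num.Def.archi_bound ((1 + L) / (pi * complex.Re B)).
have hm : 1 + L <= pi * complex.Re (2 ^+ m * B).
  have := upper_nthrootP (leqnn m); rewrite ltr_pdivrMr ?mulr_gt0 ?pi_gt0// => /ltW.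
  have -> : 2 ^+ m = (2 ^+ m)%:C :> C by rewrite rmorphXn rmorph_nat.
  by rewrite ReM_real mulrCA.
have [B'0 B'th] := th0 m.
move: (2 ^+ m * B) B'0 B'th hm => B' B'0 B'th hm.
have := has_sumBC (theta_has_sum 0 B'0) has_sum_delta.
rewrite B'th sub0r => hd.
have : `|-1 : C| <= (expR (- L) * M)%:C.
  apply: (has_sum_le hd) => A.
  apply: le_trans (_ : (expR (- L) * \sum_(n <- A) expR (- (`|n|%N%:R)))%:C <= _); last first.
    by rewrite lecR ler_wpM2l ?expR_ge0.
  rewrite mulr_sumr rmorph_sum; apply: ler_sum => n _.
  case: eqP => [->|n0].
    rewrite /theta_term expr0n mulr0 oppr0 mul0r addr0 e2pi0 subrr normr0 ler0c.
    by rewrite mulr_ge0 ?expR_ge0.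
  rewrite subr0 norm_theta_term lecR -expRD ler_expR mulr0 addr0.
  set k : R := `|n|%N%:R.
  have kE : k = `|n%:~R| by rewrite /k natr_absz intr_norm.
  have -> : (n%:~R : R) ^+ 2 = k ^+ 2 by rewrite kE real_normK// num_real.
  have k1 : 1 <= k by rewrite ler1n absz_gt0; apply/eqP.
  have L0 : 0 <= L by rewrite addr_ge0.
  have kk : k <= k ^+ 2 by rewrite expr2 ler_peMr// (le_trans ler01).
  have k21 : 1 <= k ^+ 2 by exact: le_trans kk.
  have : (1 + L) * k ^+ 2 <= pi * complex.Re B' * k ^+ 2 by rewrite ler_wpM2r// sqr_ge0.
  nra.
rewrite normrN1 -[1 : C]/(1%:C) lecR => h1.
have e1 := expR_ge1Dx L.
have e2 : expR (- L) * expR L = 1 by rewrite -expRD addNr expR0.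
have e3 := expR_gt0 (- L).
have e4 : M < expR L.
  have lM := ler_norm M; have LE : L = `|M| + 1 by [].
  move: (L) (`|M|) LE lM e1 => l a -> lM e1; lra.
have : expR (- L) * M < 1 by rewrite -e2 ltr_pM2l.
by rewrite ltNge h1.
Qed.

End ThetaNonzero.

(** * Continuity at a point and punctured neighbourhoods *)

Section Continuity.
Variable K : numFieldType.
Implicit Types (f g : K -> K) (x : K).

(** Named so that [cts_auto] can recognise the goal by its head symbol. *)
Definition cts f x : Prop := {for x, continuous f}.

Lemma cts_cst (c x : K) : cts (fun _ : K => c) x.
Proof. exact: cst_continuous. Qed.

Lemma cts_id x : cts (fun z : K => z) x.
Proof. by move=> P. Qed.

Lemma ctsD f g x : cts f x -> cts g x ->
  cts (fun z => f z + g z) x.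
Proof. by move=> fc gc; exact: (cvgD fc gc). Qed.

Lemma ctsN f x : cts f x -> cts (fun z => - f z) x.
Proof. by move=> fc; exact: (cvgN fc). Qed.

Lemma ctsM f g x : cts f x -> cts g x ->
  cts (fun z => f z * g z) x.
Proof. by move=> fc gc; exact: (cvgM fc gc). Qed.

Lemma ctsX f n x : cts f x -> cts (fun z => f z ^+ n) x.
Proof.
move=> fc; elim: n => [|[|n] IH]; [exact: cts_cst|exact: fc|exact: (ctsM fc IH)].
Qed.

Lemma ctsV f x : f x != 0 -> cts f x -> cts (fun z => (f z)^-1) x.
Proof. by move=> fx fc; exact: (cvgV fx fc). Qed.

Lemma cts_comp f g x : cts g x -> cts f (g x) ->
  cts (fun z => f (g z)) x.
Proof. by move=> gc fc; exact: continuous_comp gc fc. Qed.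

Lemma near0_ex (P : set K) : (\forall s \near 0, s != 0 -> P s) ->
  exists s, s != 0 /\ P s.
Proof.
move=> h; have : \forall s \near (0 : K)^', s != 0 /\ P s.
  near=> s; have s0 : s != 0 by near: s; exact: nbhs_dnbhs_neq.
  by split => //; move: s0; near: s; exact: nbhs_dnbhs.
by move=> /filter_ex[s]; exists s.
Unshelve. all: by end_near. Qed.

Lemma cts_neq0 f x : {for x, continuous f} -> f x != 0 -> \forall z \near x, f z != 0.
Proof. by move=> fc fx; exact: cvgr_neq0 fc fx. Qed.

(** Keeps at 0 an identity that was obtained by dividing by a quantity vanishing only at 0. *)
Lemma cts_eq0 f : {for 0, continuous f} -> (\forall s \near 0, s != 0 -> f s = 0) ->
  f 0 = 0.
Proof.
move=> fc f0; apply/eqP/negPn/negP => /(cts_neq0 fc) fn0.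
have [] := @near0_ex (fun _ => False); last by move=> ? [].
near=> s => s0; have : f s != 0 by near: s.
by apply/negP/negPn/eqP; move: s0; near: s.
Unshelve. all: by end_near. Qed.

(** Differentiating one function in two ways is the source of most identities between derivatives
    below. *)
Lemma cderiv_unique f x a b : cderiv f x a -> cderiv f x b -> a = b.
Proof. by move=> /derive1_cderiv <- /derive1_cderiv <-. Qed.

Lemma cderivN f x a : cderiv f x a -> cderiv (fun z => - f z) x (- a).
Proof.
move=> /(cderivM (cderiv_cst (-1) x)); rewrite mul0r add0r mulN1r.
by apply: cderiv_near; near=> z; rewrite mulN1r.
Unshelve. all: by end_near. Qed.

Lemma cderivB f g x a b : cderiv f x a -> cderiv g x b ->
  cderiv (fun z => f z - g z) x (a - b).
Proof. by move=> fa /cderivN; exact: cderivD. Qed.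

Lemma cderiv_shift f x c a : cderiv f (x + c) a -> cderiv (fun z => f (z + c)) x a.
Proof.
move=> fa; rewrite -[a]mulr1; apply: (cderiv_comp (f := fun z => z + c)) fa.
by have := cderivD (cderiv_id x) (cderiv_cst c x); rewrite addr0.
Qed.

Lemma cderiv_affine f x k c a : cderiv f (k * x + c) a ->
  cderiv (fun z => f (k * z + c)) x (a * k).
Proof.
move=> fa; apply: (cderiv_comp (f := fun z => k * z + c)) fa.
have := cderivD (cderivM (cderiv_cst k x) (cderiv_id x)) (cderiv_cst c x).
by rewrite mul0r add0r mulr1 addr0.
Qed.

End Continuity.

(** Inverses come with a nonvanishing condition and are left to [ctsV]. *)
Ltac cts_auto := repeat lazymatch goal with
 | |- cts (fun _ => ?k) _ => exact (cts_cst _ _)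
 | |- cts (fun z => z) _ => exact (cts_id _)
 | |- cts (fun z => @?f z + @?g z) _ => apply (@ctsD _ f g)
 | |- cts (fun z => - @?f z) _ => apply (@ctsN _ f)
 | |- cts (fun z => @?f z * @?g z) _ => apply (@ctsM _ f g)
 | |- cts (fun z => @?f z ^+ ?n) _ => apply (@ctsX _ f n)
 | |- cts (fun z => ?f (@?g z)) _ => apply (@cts_comp _ f g)
 end; try solve [exact: cts_cst | exact: cts_id | auto].

(** * Local form of the maximum principle *)

Section LocalMaximum.
Variable K : numClosedFieldType.

(* Along s = t d with d^n = h1 / rho(0), the perturbation is h1 t^n (1 + o(1)). *)
Lemma no_local_max (h1 : K) (rho : K -> K) n : h1 != 0 -> rho 0 != 0 ->
  {for 0, continuous rho} -> (0 < n)%N ->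
  ~ (forall s, `|h1 + s ^+ n * rho s| <= `|h1|).
Proof.
move=> h0 r0 rc n0 hmax.
pose d := n.-root (h1 / rho 0).
have dn : d ^+ n = h1 / rho 0 by rewrite rootCK.
have d0 : d != 0.
  apply/eqP => d0; move/eqP: dn; rewrite d0 expr0n gtn_eqF// eq_sym.
  by rewrite mulf_eq0 invr_eq0 (negPf h0) (negPf r0).
have : \forall s \near (0 : K), `|rho 0 - rho s| < `|rho 0| / 2.
  have e2 : 0 < `|rho 0| / 2 by rewrite divr_gt0 ?normr_gt0.
  exact: (cvgr_dist_lt rho (rho 0) rc _ e2).
move=> /nbhs_ballP[e /= e0 he].
pose t := e / (2 * `|d|).
have t0 : 0 < t by rewrite divr_gt0 ?mulr_gt0 ?normr_gt0.
have : ball (0 : K) e (t * d).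
  rewrite -ball_normE /= sub0r normrN normrM (gtr0_norm t0) /t.
  rewrite invfM mulrA mulfVK ?normr_eq0// ltr_pdivrMr// ltr_pMr// ltr1n//.
move=> /he /=; have := hmax (t * d).
rewrite exprMn dn; set r := rho (t * d) => h1le hr.
have tn : 0 < t ^+ n by rewrite exprn_gt0.
(* The subtracted term is smaller than t^n in norm, so the cofactor of [h1] has norm greater than
   1. *)
have E : h1 + t ^+ n * (h1 / rho 0) * r = h1 * ((1 + t ^+ n) - t ^+ n * ((rho 0 - r) / rho 0)).
  by field.
move: h1le; rewrite E normrM -[leRHS]mulr1 ler_pM2l ?normr_gt0//.
apply/negP; rewrite -real_ltNge ?num_real ?normr_real ?real1//.
apply: lt_le_trans (lerB_dist _ _).
rewrite (gtr0_norm (_ : 0 < 1 + t ^+ n)) ?addr_gt0// normrM (gtr0_norm tn).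
rewrite ltrBrDr ltrD2l gtr_pMr// normf_div ltr_pdivrMr ?normr_gt0// mul1r.
rewrite (lt_trans hr)// ltr_pdivrMr// ltr_pMr ?normr_gt0// ltr1n//.
Qed.

End LocalMaximum.

(* Below e(x) = exp(2 pi x), w1 = i/2 and w2 = B/2, and th_j is the j-th derivative of
   theta in u. *)
Section AbstractTheta.
Variable K : numClosedFieldType.
Variables (e th th1 th2 th3 A C : K -> K) (w1 w2 c al ga : K).
Implicit Types (u v x y z s p : K).

Hypotheses (eD : forall x y, e (x + y) = e x * e y) (e_neq0 : forall x, e x != 0)
  (ew1 : e w1 = -1) (de : forall x, cderiv e x (c * e x)).
Hypotheses (th_even : forall u, th (- u) = th u)
  (th_w1 : forall u, th (u + 2 * w1) = th u)
  (th_w2 : forall u, th (u + 2 * w2) = e (w2 + u) * th u)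
  (th_w1w2 : th (w1 + w2) = 0)
  (thT : forall u v, th (u + v) * th (u - v) = A u * A v + C u * C v).
Hypotheses (A_w1 : forall u, A (u + w1) = A u) (C_w1 : forall u, C (u + w1) = - C u)
  (A_w2 : forall u, A (u + w2) = e (w2 / 2 + u) * C u)
  (C_w2 : forall u, C (u + w2) = e (w2 / 2 + u) * A u)
  (A_even : forall u, A (- u) = A u) (C_even : forall u, C (- u) = C u)
  (A_cont : forall x, cts A x) (C_cont : forall x, cts C x).
Hypotheses (dth : forall u, cderiv th u (th1 u)) (dth1 : forall u, cderiv th1 u (th2 u))
  (dth2 : forall u, cderiv th2 u (th3 u)) (th3_cont : forall u, cts th3 u).
Hypothesis th_ord : forall p, exists k g, [/\ forall s, th (p + s) = s ^+ k * g s,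
    {for 0, continuous g} & g 0 != 0].

(** The numerators of the second and third derivatives of log th, written as polynomials so that
    they make sense at the zeros of th too. *)
Definition thN u := th u * th2 u - th1 u ^+ 2.
Definition thM u := th u ^+ 2 * th3 u - 3 * th u * th1 u * th2 u + 2 * th1 u ^+ 3.
Hypothesis thNE : forall u, thN u = al * A u + ga * C u.

Let u0 := w1 + w2.
Let N := thN.
Let M := thM.

Let e0 : e 0 = 1.
Proof. by apply: (mulfI (e_neq0 0)); rewrite -eD addr0 mulr1. Qed.

Let eN x : e (- x) = (e x)^-1.
Proof. by apply: (mulfI (e_neq0 x)); rewrite -eD subrr e0 divff. Qed.

Let thC x : cts th x. Proof. exact: cderiv_continuous (dth x). Qed.
Let eC x : cts e x. Proof. exact: cderiv_continuous (de x). Qed.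

Let D u v := A u * C v - C u * A v.

Let DE u v : D u v = e (- (w2 / 2) - v) * (th (u + v + u0) * th (u - v - u0)).
Proof.
have AE : A (v + u0) = e (w2 / 2 + v) * C v.
  by rewrite /u0 addrA A_w2 C_w1 addrA eD ew1; ring.
have CE : C (v + u0) = - (e (w2 / 2 + v) * A v).
  by rewrite /u0 addrA C_w2 A_w1 addrA eD ew1; ring.
have -> : u + v + u0 = u + (v + u0) by ring.
have -> : u - v - u0 = u - (v + u0) by ring.
rewrite thT AE CE -opprD eN /D; field; exact: e_neq0.
Qed.

Let th_isolated p : \forall s \near 0, s != 0 -> th (p + s) != 0.
Proof.
have [k [g [gE gc g0]]] := th_ord p.
have := cts_neq0 gc g0; apply: filterS => s gs s0.
by rewrite gE mulf_neq0 ?expf_neq0.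
Qed.

Let th_isolatedN p : \forall s \near 0, s != 0 -> th (p - s) != 0.
Proof.
have := th_isolated (- p); apply: filterS => s h /h.
by rewrite -th_even opprD !opprK.
Qed.

Let th_pair u : exists v, v != 0 /\ th (u + v) * th (u - v) != 0.
Proof.
apply: near0_ex; near=> s => s0; rewrite mulf_neq0//; move: s0.
  by near: s; exact: th_isolated.
by near: s; exact: th_isolatedN.
Unshelve. all: by end_near. Qed.

Let AC_neq0 u : A u = 0 -> C u = 0 -> False.
Proof.
move=> Au Cu; have [v [_]] := th_pair u.
by rewrite thT Au Cu !mul0r addr0 eqxx.
Qed.

Let th_ex : exists u, th u != 0.
Proof.
have [s [_ h]] := near0_ex (th_isolated 0).
by exists (0 + s).
Qed.

(* With D(x,y) = (y - x)^k (unit) for y near x, the relation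
     D(x,y) D(z,w) - D(x,z) D(y,w) + D(x,w) D(y,z) = 0
   at x = v, y = v + s, z = v + 2s gives 1 - 2^k + 1 = 0 as s -> 0. *)
Let ord_u0 g k : (forall s, th (u0 + s) = s ^+ k * g s) -> cts g 0 ->
  g 0 != 0 -> k = 1%N.
Proof.
move=> gE gc g0.
have thx x y : th (x - y - u0) = (y - x) ^+ k * g (y - x).
  by rewrite -gE -th_even; congr th; ring.
have [s [s0 hs]] := near0_ex (th_isolated u0).
(* [v] and [w] are chosen so that th(2v + u0) and [D v w] are nonzero; both are factors of the limit
   at s = 0. *)
pose v := s / 2.
have hv : th (2 * v + u0) != 0.
  by rewrite (_ : 2 * v + u0 = u0 + s)// /v; field.
have [t [t0 ht]] := th_pair v.
pose w := t - u0.
have hD : D v w != 0.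
  rewrite DE mulf_neq0// (_ : v + w + u0 = v + t); last by rewrite /w; ring.
  by rewrite (_ : v - w - u0 = v - t)// /w; ring.
(* The left side of the relation after division by s^k. *)
pose F s := e (- (w2 / 2) - (v + s)) * th (v + (v + s) + u0) * g s * D (v + 2 * s) w
  - 2 ^+ k * (e (- (w2 / 2) - (v + 2 * s)) * th (v + (v + 2 * s) + u0) * g (2 * s)) *
     D (v + s) w
  + e (- (w2 / 2) - (v + 2 * s)) * th (v + s + (v + 2 * s) + u0) * g s * D v w.
have Dc x y : cts (fun z => D z x) y.
  by rewrite /D; cts_auto.
have gc2 : cts g (2 * 0) by rewrite mulr0.
have Fc : cts F 0.
  by rewrite /F /D; cts_auto.
have F0 : F 0 = 0.
  apply: cts_eq0 Fc _; near=> r => r0.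
  have sk : r ^+ k != 0 by rewrite expf_neq0.
  apply: (mulfI sk); rewrite mulr0.
  have := DE v (v + r); have := DE v (v + 2 * r); have := DE (v + r) (v + 2 * r).
  rewrite !thx.
  rewrite (_ : v + r - v = r); last by ring.
  rewrite (_ : v + 2 * r - v = 2 * r); last by ring.
  rewrite (_ : v + 2 * r - (v + r) = r); last by ring.
  rewrite exprMn => E1 E2 E3.
  have P : D v (v + r) * D (v + 2 * r) w - D v (v + 2 * r) * D (v + r) w
    + D v w * D (v + r) (v + 2 * r) = 0 by rewrite /D; ring.
  by rewrite -[RHS]P E1 E2 E3 /F; ring.
have : F 0 = e (- (w2 / 2) - v) * th (2 * v + u0) * g 0 * D v w * (2 - 2 ^+ k).
  rewrite /F !mulr0 !addr0 (_ : v + v = 2 * v); last by ring.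
  ring.
rewrite F0 => /esym/eqP; rewrite mulf_eq0 => /orP[|].
  by rewrite (negPf (mulf_neq0 (mulf_neq0 (mulf_neq0 (e_neq0 _) hv) g0) hD)).
rewrite subr_eq0 -natrX eqr_nat eq_sym.
case: k {gE thx F Fc F0} => [//|[//|k]].
by move=> /eqP; rewrite !expnS; lia.
Unshelve. all: by end_near. Qed.

Let th1_ord p g : (forall s, th (p + s) = s * g s) -> cts g 0 -> th1 p = g 0.
Proof.
move=> gE gc; have thp : th p = 0 by rewrite -[p]addr0 gE mul0r.
have [g' [hg gc' <-]] := dth p.
have pE : p + 0 = p by rewrite addr0.
have gc2 : cts g' (p + 0) by rewrite pE.
pose F s := g' (p + s) - g s.
have Fc : cts F 0 by rewrite /F; cts_auto.
have hg0 := (nbhs0P _ _).1 hg.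
have F0 : F 0 = 0.
  apply: cts_eq0 Fc _; near=> s => s0; apply: (mulfI s0); rewrite mulr0 mulrBr -gE.
  have -> : th (p + s) = th p + g' (p + s) * (p + s - p) by near: s.
  by rewrite thp; ring.
by move: F0 => /eqP; rewrite /F pE subr_eq0 => /eqP.
Unshelve. all: by end_near. Qed.

Let th_ord_u0 : exists g, [/\ forall s, th (u0 + s) = s * g s, cts g 0 & g 0 != 0].
Proof.
have [k [g [gE gc g0]]] := th_ord u0.
have k1 := ord_u0 gE gc g0; rewrite k1 in gE.
by exists g; split => // s; rewrite gE expr1.
Qed.

Let A_u0 : A u0 = e (w2 / 2) * C 0.
Proof.
rewrite /u0 A_w2 -[w1]add0r C_w1 add0r eD ew1; ring.
Qed.

Let C_u0 : C u0 = - (e (w2 / 2) * A 0).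
Proof.
rewrite /u0 C_w2 -[w1]add0r A_w1 add0r eD ew1; ring.
Qed.

(* A zero p makes (A, C)(p) orthogonal to (A, C)(0), hence parallel to (A, C)(u0). *)
Let th_pair_zero p : th p = 0 -> exists2 l, l != 0 &
  forall s, th (p + s) * th (p - s) = l * (th (u0 + s) * th (u0 - s)).
Proof.
move=> thp.
have h0 : A p * A 0 + C p * C 0 = 0 by rewrite -thT addr0 thp mul0r.
have hu s : th (u0 + s) * th (u0 - s) = e (w2 / 2) * (C 0 * A s - A 0 * C s).
  by rewrite thT A_u0 C_u0; ring.
have ez := e_neq0 (w2 / 2).
have [A0|A0] := eqVneq (A 0) 0.
  have C0 : C 0 != 0 by apply/eqP => /(AC_neq0 A0).
  have Cp : C p = 0.
    by move: h0; rewrite A0 mulr0 add0r => /eqP; rewrite mulf_eq0 (negPf C0) orbF => /eqP.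
  exists (A p / (e (w2 / 2) * C 0)) => [|s].
    rewrite mulf_neq0 ?invr_eq0 ?mulf_neq0//; apply/eqP => Ap; exact: AC_neq0 Ap Cp.
  by rewrite hu thT Cp A0; field; rewrite ez C0.
have Cp : C p != 0.
  apply/eqP => Cp; move/eqP: h0; rewrite Cp mul0r addr0 mulf_eq0 (negPf A0) orbF.
  by move=> /eqP Ap; exact: AC_neq0 Ap Cp.
exists (- (C p / (e (w2 / 2) * A 0))) => [|s].
  by rewrite oppr_eq0 mulf_neq0 ?invr_eq0 ?mulf_neq0.
have -> : th (p + s) * th (p - s) = (A p * A 0 * A s + C p * C s * A 0) / A 0.
  by rewrite thT; field.
rewrite (_ : A p * A 0 = - (C p * C 0)).
  by rewrite hu; field; rewrite ez A0.
by apply/eqP; rewrite -addr_eq0 h0.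
Qed.

(** By [th_pair_zero], th(p + s) th(p - s) vanishes at s = 0 to the same order as at u0, namely 2,
    whereas a zero of order k would give order 2k. *)
Lemma th1_neq0 p : th p = 0 -> th1 p != 0.
Proof.
move=> thp; have [l l0 hl] := th_pair_zero thp.
have [g [gE gc g0]] := th_ord_u0.
have [[|[|k]] [h [hE hc h0]]] := th_ord p.
- by move: (hE 0); rewrite addr0 thp mul1r => /esym/eqP; rewrite (negPf h0).
- by rewrite (th1_ord (g := h))// => s; rewrite hE expr1.
have gcN : cts g (- 0) by rewrite oppr0.
have hcN : cts h (- 0) by rewrite oppr0.
(* Here p has order k + 2, so division by s^2 leaves s^(2k + 2), which still vanishes at 0. *)
pose F s := s ^+ (2 * k).+2 * (-1) ^+ k * (h s * h (- s)) + l * (g s * g (- s)).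
have Fc : cts F 0 by rewrite /F; cts_auto.
have F0 : F 0 = 0.
  apply: cts_eq0 Fc _; near=> s => s0.
  have := hl s; rewrite !hE !gE => E.
  apply: (mulfI (_ : s ^+ 2 != 0)); first by rewrite expf_neq0.
  rewrite mulr0 /F mulrDr.
  have -> : s ^+ 2 * (l * (g s * g (- s))) = - (l * (s * g s * (- s * g (- s)))) by ring.
  rewrite -E -[- s]mulN1r exprMn mul2n -addnn !exprS exprD; ring.
move: F0; rewrite /F exprS !mul0r add0r oppr0 => /eqP.
by rewrite !mulf_eq0 (negPf l0) (negPf g0).
Unshelve. all: by end_near. Qed.

Let th1_odd u : th1 (- u) = - th1 u.
Proof.
have h : cderiv th u (th1 (- u) * -1).
  have := @cderiv_affine _ th u (-1) 0 (th1 (- u)).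
  rewrite mulN1r addr0 => /(_ (dth _)); apply: cderiv_near.
  by near=> z; rewrite mulN1r addr0 th_even.
by apply: oppr_inj; rewrite opprK -(cderiv_unique h (dth u)) mulrN1.
Unshelve. all: by end_near. Qed.

Let th1_w1 u : th1 (u + 2 * w1) = th1 u.
Proof.
have h := cderiv_shift (dth (u + 2 * w1)).
apply: (cderiv_unique (f := th) (x := u)) (dth u).
by apply: cderiv_near h; near=> z; rewrite th_w1.
Unshelve. all: by end_near. Qed.

Let de2 u : cderiv (fun z => e (w2 + z)) u (c * e (w2 + u)).
Proof.
have h := cderiv_shift (de (u + w2)); rewrite addrC in h.
by apply: cderiv_near h; near=> z; rewrite addrC.
Unshelve. all: by end_near. Qed.

Let th1_w2 u : th1 (u + 2 * w2) = e (w2 + u) * (c * th u + th1 u).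
Proof.
have h := cderiv_shift (dth (u + 2 * w2)).
have h2 : cderiv (fun z => th (z + 2 * w2)) u (c * e (w2 + u) * th u + e (w2 + u) * th1 u).
  by apply: cderiv_near (cderivM (de2 u) (dth u)); near=> z; rewrite th_w2.
rewrite (cderiv_unique h h2); ring.
Unshelve. all: by end_near. Qed.

Let half_eq0 x : x = - x -> x = 0.
Proof. by move=> /eqP; rewrite -addr_eq0 -mulr2n mulrn_eq0 /= => /eqP. Qed.

(** Reflection in a half period preserves th up to a factor, so a zero there would also be a zero of
    th1, contrary to [th1_neq0]. The next two lemmas apply the same argument to w1 and w2. *)
Lemma th_0 : th 0 != 0.
Proof.
apply/eqP => /th1_neq0/eqP; apply; apply: half_eq0.
by rewrite -th1_odd oppr0.
Qed.

Lemma th_half1 : th w1 != 0.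
Proof.
apply/eqP => /th1_neq0/eqP; apply; apply: half_eq0.
by rewrite -th1_odd -(th1_w1 (- w1)); congr th1; ring.
Qed.

Lemma th_half2 : th w2 != 0.
Proof.
apply/eqP => h; have /eqP := th1_neq0 h; apply; apply: half_eq0.
have := th1_w2 (- w2); rewrite subrr e0 th_even h mulr0 add0r mul1r th1_odd => <-.
by congr th1; ring.
Qed.

(** Determinant of the coefficients of N and th^2 in terms of A and C. It is nonzero because N(u0) =
    -th1(u0)^2 whereas th(u0) = 0. *)
Let wr := al * C 0 - ga * A 0.

Let thsq v : th v ^+ 2 = A v * A 0 + C v * C 0.
Proof. by rewrite -thT addr0 subr0 expr2. Qed.

Let N_cross u v : N u * th v ^+ 2 - N v * th u ^+ 2 = wr * D u v.
Proof. rewrite /N !thNE !thsq /D /wr; ring. Qed.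

Let N_u0 : N u0 = - th1 u0 ^+ 2.
Proof. by rewrite /N /thN th_w1w2 mul0r sub0r. Qed.

Let th1_u0 : th1 u0 != 0. Proof. exact: th1_neq0. Qed.

Let wr_neq0 : wr != 0.
Proof.
apply/eqP => w0; have [v hv] := th_ex.
have := N_cross u0 v; rewrite w0 mul0r th_w1w2 expr0n mulr0 subr0 N_u0 => /eqP.
by rewrite mulf_eq0 oppr_eq0 !expf_eq0 /= (negPf th1_u0) (negPf hv).
Qed.

Let dN u : cderiv N u (th u * th3 u - th1 u * th2 u).
Proof.
have h := cderivB (cderivM (dth u) (dth2 u)) (cderivM (dth1 u) (dth1 u)).
rewrite (_ : _ - _ = th u * th3 u - th1 u * th2 u) in h; last by ring.
by apply: cderiv_near h; near=> z; rewrite /N /thN expr2.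
Unshelve. all: by end_near. Qed.

(** The cross expression N(z) th(u)^2 - N(u) th(z)^2 is differentiated at z = u directly and through
    the factored determinant, where th(-u0) = 0 removes one of the two terms. *)
Let thM_double u : th u * M u =
  - (wr * th1 u0 * e (- (w2 / 2) - u)) * th (2 * u + u0).
Proof.
pose F z := N z * th u ^+ 2 - N u * (th z * th z).
have h1 : cderiv F u (th u * M u).
  have h := cderivB (cderivM (dN u) (cderiv_cst (th u ^+ 2) u))
    (cderivM (cderiv_cst (N u) u) (cderivM (dth u) (dth u))).
  rewrite (_ : _ - _ = th u * M u) in h => //.
  by rewrite /M /thM /cst /N /thN; ring.
pose k := wr * e (- (w2 / 2) - u).
have h2 : cderiv F u (k * (th1 (u + (u + u0)) * th (u + (- u - u0)) +
    th (u + (u + u0)) * th1 (u + (- u - u0)))).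
  have h := cderivM (cderiv_cst k u) (cderivM (cderiv_shift (dth (u + (u + u0))))
     (cderiv_shift (dth (u + (- u - u0))))).
  rewrite mul0r add0r in h; apply: cderiv_near h; near=> z.
  rewrite /F -expr2 N_cross DE /cst /k !addrA; ring.
rewrite (cderiv_unique h1 h2) /k.
have -> : u + (u + u0) = 2 * u + u0 by ring.
have -> : u + (- u - u0) = - u0 by ring.
rewrite th_even th1_odd th_w1w2; ring.
Unshelve. all: by end_near. Qed.

(** A and C take the same value at -(w2 / 2), which turns th(u) th(u + w2) into a multiple of A + C
    at u + w2 / 2. *)
Let kap := A (- (w2 / 2)).

Let kapC : C (- (w2 / 2)) = kap.
Proof.
rewrite /kap -C_even opprK -[LHS](_ : C (- (w2 / 2) + w2) = _); last by congr C; field.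
by rewrite C_w2 subrr e0 mul1r.
Qed.

Let kap_neq0 : kap != 0.
Proof. by apply/eqP => k0; apply: (@AC_neq0 (- (w2 / 2))); rewrite ?kapC. Qed.

Let th_landen u : th u * th (u + w2) = kap * (A (u + w2 / 2) + C (u + w2 / 2)).
Proof.
have := thT (u + w2 / 2) (- (w2 / 2)); rewrite kapC -/kap.
rewrite (_ : u + w2 / 2 - - (w2 / 2) = u + w2); last by field.
by rewrite addrK => ->; ring.
Qed.

(** The pairs (u, u + w2) and (u + w1, u + u0) contribute kap (A + C) and kap (A - C) at u + w2/2,
    and A^2 - C^2 is again an instance of the addition formula. *)
Lemma th_duplication u : th u * th (u + w1) * th (u + w2) * th (u + u0) =
  kap ^+ 2 * th w1 * th (2 * u + u0).
Proof.
have h1 := th_landen u; have h2 := th_landen (u + w1).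
rewrite (_ : u + w1 + w2 / 2 = u + w2 / 2 + w1) in h2; last by ring.
rewrite A_w1 C_w1 (_ : u + w1 + w2 = u + u0) in h2; last by rewrite /u0; ring.
have := thT (u + w2 / 2 + w1) (u + w2 / 2); rewrite A_w1 C_w1.
rewrite (_ : u + w2 / 2 + w1 + (u + w2 / 2) = 2 * u + u0); last by rewrite /u0; field.
rewrite (_ : u + w2 / 2 + w1 - (u + w2 / 2) = w1); last by ring.
move=> h3.
have -> : kap ^+ 2 * th w1 * th (2 * u + u0) = kap ^+ 2 * (th (2 * u + u0) * th w1) by ring.
rewrite h3.
transitivity ((th u * th (u + w2)) * (th (u + w1) * th (u + u0))); first by ring.
by rewrite h1 h2; ring.
Qed.

Let P u := th (u + w1) * th (u + w2) * th (u + u0).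

(** Eliminating th(2u + u0) between [thM_double] and [th_duplication] leaves a common factor th(u).
    It is cancelled away from the isolated zeros, and continuity does the rest. *)
Let thM_prod u : kap ^+ 2 * th w1 * e u * M u = - (wr * th1 u0 * e (- (w2 / 2))) * P u.
Proof.
have Nc v : cts N v by exact: cderiv_continuous (dN v).
have th1c v : cts th1 v by exact: cderiv_continuous (dth1 v).
have th2c v : cts th2 v by exact: cderiv_continuous (dth2 v).
pose F s := kap ^+ 2 * th w1 * e (u + s) * M (u + s) +
  wr * th1 u0 * e (- (w2 / 2)) * P (u + s).
have Fc : cts F 0 by rewrite /F /M /thM /P; cts_auto.
have key z : th z * (kap ^+ 2 * th w1 * e z * M z + wr * th1 u0 * e (- (w2 / 2)) * P z) = 0.
  have E1 := thM_double z; have E2 := th_duplication z.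
  have ez : e (- (w2 / 2) - z) = e (- (w2 / 2)) / e z by rewrite eD (eN z).
  transitivity (kap ^+ 2 * th w1 * e z * (th z * M z) + wr * th1 u0 * e (- (w2 / 2)) *
    (th z * th (z + w1) * th (z + w2) * th (z + u0))); first by rewrite /P; ring.
  by rewrite E1 E2 ez; field; rewrite e_neq0.
have F0 : F 0 = 0.
  apply: cts_eq0 Fc _; have := th_isolated u; apply: filterS => s h /h hs.
  by apply: (mulfI hs); rewrite mulr0 /F key.
by apply/eqP; rewrite mulNr -addr_eq0; move: F0; rewrite /F addr0 => ->.
Qed.

(** At a half period v the arguments u + v + u0 and u - v - u0 differ by the period 2v + 2 u0, so
    the two theta factors of the determinant merge into the square of one translate. [q1] and [q2]
    are the cases v = w1 and v = w2. *)
Let q0 u : e u * (N u * th 0 ^+ 2 - N 0 * th u ^+ 2) =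
  - (wr * e (- (w2 / 2))) * th (u + u0) ^+ 2.
Proof.
rewrite N_cross DE addr0 !subr0.
have : th (u + u0) = - e u * th (u - u0).
  have h1 := th_w2 (u - u0); have h2 := th_w1 (u - u0 + 2 * w2).
  rewrite (_ : u - u0 + 2 * w2 + 2 * w1 = u + u0) in h2; last by rewrite /u0; ring.
  rewrite h2 h1 (_ : w2 + (u - u0) = u + - w1); last by rewrite /u0; ring.
  by rewrite eD eN ew1; field.
by move=> ->; ring.
Qed.

Let q1 u : e u * (N u * th w1 ^+ 2 - N w1 * th u ^+ 2) =
  - (wr * e (- (w2 / 2))) * th (u + w2) ^+ 2.
Proof.
rewrite N_cross DE.
have -> : th (u + w1 + u0) = th (u + w2).
  by rewrite -(th_w1 (u + w2)); congr th; rewrite /u0; ring.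
have -> : th (u - w1 - u0) = th (u - w2).
  by rewrite -(th_w1 (u - w1 - u0)); congr th; rewrite /u0; ring.
have : th (u + w2) = e u * th (u - w2).
  have := th_w2 (u - w2).
  rewrite (_ : w2 + (u - w2) = u); last by ring.
  by rewrite (_ : u - w2 + 2 * w2 = u + w2); last by ring.
by move=> ->; rewrite eD [e (- w1)]eN ew1; field.
Qed.

Let q2 u : N u * th w2 ^+ 2 - N w2 * th u ^+ 2 =
  wr * e (w2 / 2) * th (u + w1) ^+ 2.
Proof.
rewrite N_cross DE.
have -> : th (u + w2 + u0) = e (w2 + (u + w1)) * th (u + w1).
  by rewrite -th_w2; congr th; rewrite /u0; ring.
have : e (u - u0) * th (u - w2 - u0) = th (u + w1).
  have := th_w2 (u - w2 - u0).
  rewrite (_ : w2 + (u - w2 - u0) = u - u0); last by ring.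
  rewrite -(th_w1 (_ + _)) => <-; congr th; rewrite /u0; ring.
rewrite (_ : th (u + w1) ^+ 2 = th (u + w1) * th (u + w1)) ?expr2//.
move=> {2}<-; rewrite /u0 (_ : u - (w1 + w2) = u + (- w1 - w2)); last by ring.
have -> : e (w2 / 2) = e (- (w2 / 2) - w2) * e (w2 * 2).
  by rewrite -eD; congr e; field.
rewrite (_ : w2 * 2 = w2 + w2); last by ring.
rewrite !eD !eN ew1; field; rewrite !e_neq0.
by [].
Qed.

Let E1 := N 0 / th 0 ^+ 2.
Let E2 := N w1 / th w1 ^+ 2.
Let E3 := N w2 / th w2 ^+ 2.

Lemma thM_cubic u : M u ^+ 2 =
  -4 * (N u - E1 * th u ^+ 2) * (N u - E2 * th u ^+ 2) * (N u - E3 * th u ^+ 2).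
Proof.
pose Q u := (N u - E1 * th u ^+ 2) * (N u - E2 * th u ^+ 2) * (N u - E3 * th u ^+ 2).
have h0 := th_0; have h1 := th_half1; have h2 := th_half2.
(* The square of the factor in [thM_prod] divided by the product of those in [q0], [q1] and [q2];
   the squares of the three translates of th cancel. *)
pose r := th1 u0 ^+ 2 * th 0 ^+ 2 * th w1 ^+ 2 * th w2 ^+ 2 /
  (wr * e (w2 / 2) * (kap ^+ 2 * th w1) ^+ 2).
have key v : M v ^+ 2 = r * Q v.
  have ev := e_neq0 v; have ew := e_neq0 (w2 / 2).
  have Hm := thM_prod v; have H0 := q0 v; have H1 := q1 v; have H2 := q2 v.
  have mE : M v = - (wr * th1 u0 * e (- (w2 / 2))) * P v / (kap ^+ 2 * th w1 * e v).
    by rewrite -Hm; field; rewrite ev h1 kap_neq0.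
  have n0 : N v - E1 * th v ^+ 2 =
      - (wr * e (- (w2 / 2))) * th (v + u0) ^+ 2 / (e v * th 0 ^+ 2).
    by rewrite -H0 /E1; field; rewrite ev h0.
  have n1 : N v - E2 * th v ^+ 2 =
      - (wr * e (- (w2 / 2))) * th (v + w2) ^+ 2 / (e v * th w1 ^+ 2).
    by rewrite -H1 /E2; field; rewrite ev h1.
  have n2 : N v - E3 * th v ^+ 2 = wr * e (w2 / 2) * th (v + w1) ^+ 2 / th w2 ^+ 2.
    by rewrite -H2 /E3; field.
  rewrite /Q n0 n1 n2 mE /P /r eN; field.
  by rewrite ev ew h0 h1 h2 wr_neq0 kap_neq0.
(* At u0, M = 2 th1^3 and every N - E_j th^2 equals -th1^2, hence 4 th1^6 = -r th1^6. *)
have rE : r = -4.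
  have := key u0; rewrite /Q N_u0 /M /thM th_w1w2 expr0n /= !mulr0 !mul0r !subr0.
  rewrite add0r => h.
  have t0 : th1 u0 ^+ 6 != 0 by rewrite expf_neq0.
  apply: (mulIf t0); apply/eqP; rewrite -subr_eq0; apply/eqP.
  transitivity ((2 * th1 u0 ^+ 3) ^+ 2 * -1 + 4 * th1 u0 ^+ 6); last by ring.
  by rewrite h; ring.
by rewrite key rE /Q; ring.
Qed.

Lemma thN_w1 u : N (u + 2 * w1) = N u.
Proof.
have -> : u + 2 * w1 = u + w1 + w1 by ring.
by rewrite /N !thNE !A_w1 !C_w1 opprK.
Qed.

Lemma thN_w2 u : N (u + 2 * w2) = e (w2 + u) ^+ 2 * N u.
Proof.
have -> : u + 2 * w2 = u + w2 + w2 by ring.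
rewrite /N !thNE !A_w2 !C_w2 !A_w2.
have -> : e (w2 + u) ^+ 2 = e (w2 / 2 + (u + w2)) * e (w2 / 2 + u).
  by rewrite expr2 -!eD; congr e; field.
ring.
Qed.

Lemma thN_cont u : cts N u.
Proof. exact: cderiv_continuous (dN u). Qed.

Lemma thM_cont u : cts M u.
Proof.
have th1c v : cts th1 v by exact: cderiv_continuous (dth1 v).
have th2c v : cts th2 v by exact: cderiv_continuous (dth2 v).
by rewrite /M /thM; cts_auto.
Qed.

Lemma th_nonzero_near u : \forall s \near 0, s != 0 -> th (u + s) != 0.
Proof. exact: th_isolated. Qed.

Lemma cderiv_dlog u : th u != 0 -> cderiv (fun z => th1 z / th z) u (N u / th u ^+ 2).
Proof.
move=> t0; have h := cderivM (dth1 u) (cderivV t0 (dth u)).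
rewrite (_ : _ + _ = N u / th u ^+ 2) in h => //.
by rewrite /N /thN; field.
Qed.

Lemma cderiv_d2log u : th u != 0 -> cderiv (fun z => N z / th z ^+ 2) u (M u / th u ^+ 3).
Proof.
move=> t0; have t20 : th u * th u != 0 by rewrite mulf_neq0.
have h := cderivM (dN u) (cderivV (f := fun z => th z * th z) t20 (cderivM (dth u) (dth u))).
have E : (th u * th3 u - th1 u * th2 u) * (th u * th u)^-1 +
    N u * - ((th1 u * th u + th u * th1 u) / (th u * th u) ^+ 2) = M u / th u ^+ 3.
  by rewrite /M /thM /N /thN; field.
rewrite E in h.
by apply: cderiv_near h; near=> z; rewrite expr2.
Unshelve. all: by end_near. Qed.

Lemma thN_even u : N (- u) = N u.
Proof. by rewrite /N !thNE A_even C_even. Qed.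

Let N1 u := th u * th3 u - th1 u * th2 u.

Let ME u : M u = N1 u * th u - 2 * N u * th1 u.
Proof. rewrite /M /thM /N1 /N /thN; ring. Qed.

Let N1_w1 u : N1 (u + 2 * w1) = N1 u.
Proof.
have h := cderiv_shift (dN (u + 2 * w1)).
apply: (cderiv_unique (f := N) (x := u)) (dN u).
by apply: cderiv_near h; near=> z; rewrite thN_w1.
Unshelve. all: by end_near. Qed.

Let N1_w2 u : N1 (u + 2 * w2) = e (w2 + u) ^+ 2 * (2 * c * N u + N1 u).
Proof.
have h := cderiv_shift (dN (u + 2 * w2)).
have h2 := cderivM (cderivM (de2 u) (de2 u)) (dN u).
have {}h2 := cderiv_near _ h2 (f := fun z => N (z + 2 * w2)).
rewrite -/(N1 _) /= in h h2; rewrite (cderiv_unique h (h2 _)); first by rewrite -/(N1 u); ring.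
by near=> z; rewrite thN_w2 expr2.
Unshelve. all: by end_near. Qed.

Let N1_odd u : N1 (- u) = - N1 u.
Proof.
have h : cderiv N u (N1 (- u) * -1).
  have := @cderiv_affine _ N u (-1) 0 (N1 (- u)).
  rewrite mulN1r addr0 => /(_ (dN _)); apply: cderiv_near.
  by near=> z; rewrite mulN1r addr0 thN_even.
by apply: oppr_inj; rewrite opprK -mulrN1; exact: (cderiv_unique h (dN u)).
Unshelve. all: by end_near. Qed.

Lemma thM_w1 u : M (u + 2 * w1) = M u.
Proof. by rewrite !ME N1_w1 thN_w1 th_w1 th1_w1. Qed.

Lemma thM_w2 u : M (u + 2 * w2) = e (w2 + u) ^+ 3 * M u.
Proof. rewrite !ME N1_w2 thN_w2 th_w2 th1_w2; ring. Qed.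

Lemma thM_odd u : M (- u) = - M u.
Proof. rewrite !ME N1_odd thN_even th_even th1_odd; ring. Qed.

(** Stands for compactness of a period parallelogram, which an abstract closed field does not
    provide. *)
Hypothesis periodic_max : forall h : K -> K, (forall x, cts h x) ->
  (forall u, h (u + 2 * w1) = h u) -> (forall u, h (u + 2 * w2) = h u) ->
  exists u1, forall u, `|h u| <= `|h u1|.

(* For G = N - y th^2 without zeros, h = th^2/G satisfies h(u) - h(u1) =
   -wr D(u,u1)/(G(u) G(u1)), which is not flat at u1, so |h| has no maximum. *)
Lemma thN_surj (y : K) : exists u, N u = y * th u ^+ 2.
Proof.
apply: contrapT => /forallNP nex.
pose G u := N u - y * th u ^+ 2.
have G0 u : G u != 0.
  by apply/eqP => /eqP; rewrite subr_eq0 => /eqP; exact: nex.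
have Nc v : cts N v by exact: cderiv_continuous (dN v).
have Gc v : cts G v by rewrite /G; cts_auto.
pose h u := th u ^+ 2 * (G u)^-1.
have hc v : cts h v by rewrite /h; apply: ctsM; [cts_auto|exact: ctsV].
have [||u1 hu1] := periodic_max hc.
- by move=> u; rewrite /h /G thN_w1 th_w1.
- move=> u; have GE : G (u + 2 * w2) = e (w2 + u) ^+ 2 * G u.
    by rewrite /G thN_w2 th_w2; ring.
  rewrite /h GE th_w2; move: (G u) (G0 u) => g g0.
  by field; rewrite e_neq0 g0.
have h10 : h u1 != 0.
  have [v hv] := th_ex; have := hu1 v; apply: contraTneq => ->.
  by rewrite normr0 normr_le0 mulf_neq0 ?invr_eq0 ?expf_neq0.
have [g [gE gc g0]] := th_ord_u0.
have [k [g' [gE' gc' g0']]] := th_ord (2 * u1 + u0).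
have gcN : cts g (- 0) by rewrite oppr0.
(* One factor s comes from the simple zero u0, and s^k from the order k >= 0 of th at 2 u1 + u0. The
   constant y cancels from the numerator. *)
pose rho s := wr * e (- (w2 / 2) - u1) * (g' s * g (- s)) * (G u1 * G (u1 + s))^-1.
have rc : cts rho 0.
  rewrite /rho; apply: ctsM; first by cts_auto.
  by apply: ctsV; [rewrite mulf_neq0|cts_auto].
have r0 : rho 0 != 0.
  by rewrite /rho oppr0 !mulf_neq0 ?invr_eq0 ?mulf_neq0.
apply: (no_local_max h10 r0 rc (ltn0Sn k)) => s.
rewrite (_ : h u1 + _ = h (u1 + s)); first exact: hu1.
have := N_cross (u1 + s) u1; rewrite DE.
rewrite (_ : u1 + s + u1 + u0 = 2 * u1 + u0 + s); last by ring.
rewrite (_ : u1 + s - u1 - u0 = - (u0 + - s)); last by ring.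
rewrite th_even gE gE' => E.
have E' : G u1 * th (u1 + s) ^+ 2 - G (u1 + s) * th u1 ^+ 2 =
    - (wr * (e (- (w2 / 2) - u1) * (s ^+ k * g' s * (- s * g (- s))))).
  by rewrite -E /G; ring.
have n1 := G0 u1; have n2 := G0 (u1 + s); rewrite /h /rho [s ^+ k.+1]exprS.
have -> : th (u1 + s) ^+ 2 / G (u1 + s) = (G u1 * th (u1 + s) ^+ 2 -
    G (u1 + s) * th u1 ^+ 2) / (G u1 * G (u1 + s)) + th u1 ^+ 2 / G u1.
  by move: (G u1) (G (u1 + s)) n1 n2 => a b n1 n2; field; rewrite n1 n2.
by rewrite E'; move: ((G u1 * G (u1 + s))^-1) ((G u1)^-1) (s ^+ k) => a b d; ring.
Qed.

End AbstractTheta.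

Lemma cts_epsP (K : numFieldType) (f : K -> K) x : cts f x <->
  (forall eps, 0 < eps -> exists2 d, 0 < d & forall z, `|z - x| < d -> `|f z - f x| < eps).
Proof.
split=> [fc eps e0|h].
  have H : \forall z \near x, `|f x - f z| < eps by exact: (cvgr_dist_lt f (f x) fc _ e0).
  have [d /= d0 hd] := (nbhs_ballP _ _).1 H; exists d => // z zd.
  rewrite distrC; apply: hd; by rewrite -ball_normE /= distrC.
apply: (@cvgrPdist_lt K K K (nbhs x) _ f (f x)).2 => eps /h[d d0 hd].
near=> z; rewrite distrC; apply: hd; near: z; exact: near_dist.
Unshelve. all: by end_near. Qed.

(** Two derivatives of the addition formula in v at v = 0 give 2 N(u) on the left and A(u) A''(0) +
    C(u) C''(0) on the right. *)
Lemma thN_bilinear (K : numClosedFieldType) (th th1 th2 A A1 A2 C C1 C2 : K -> K) :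
  (forall u, cderiv th u (th1 u)) -> (forall u, cderiv th1 u (th2 u)) ->
  (forall u, cderiv A u (A1 u)) -> (forall u, cderiv A1 u (A2 u)) ->
  (forall u, cderiv C u (C1 u)) -> (forall u, cderiv C1 u (C2 u)) ->
  (forall u v, th (u + v) * th (u - v) = A u * A v + C u * C v) ->
  forall u, thN th th1 th2 u = A2 0 / 2 * A u + C2 0 / 2 * C u.
Proof.
move=> dth dth1 dA dA1 dC dC1 thT u.
have shP (f f' : K -> K) v : (forall v, cderiv f v (f' v)) ->
    cderiv (fun z => f (u + z)) v (f' (u + v)).
  move=> df; have := @cderiv_affine _ f v 1 u (f' (u + v)); rewrite mul1r addrC mulr1.
  move=> /(_ (df _)); apply: cderiv_near; near=> z; by rewrite mul1r addrC.
have shN (f f' : K -> K) v : (forall v, cderiv f v (f' v)) ->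
    cderiv (fun z => f (u - z)) v (- f' (u - v)).
  move=> df; have := @cderiv_affine _ f v (-1) u (f' (u - v)); rewrite mulN1r addrC mulrN1.
  move=> /(_ (df _)); apply: cderiv_near; near=> z; by rewrite mulN1r addrC.
have cM (k : K) (f f' : K -> K) v : (forall v, cderiv f v (f' v)) ->
    cderiv (fun z => k * f z) v (k * f' v).
  by move=> df; have := cderivM (cderiv_cst k v) (df v); rewrite mul0r add0r.
have first v : th1 (u + v) * th (u - v) - th (u + v) * th1 (u - v) =
    A u * A1 v + C u * C1 v.
  have h1 := cderivM (shP _ _ v dth) (shN _ _ v dth); rewrite mulrN in h1.
  apply: (cderiv_unique h1).
  have h2 := cderivD (cM (A u) _ _ v dA) (cM (C u) _ _ v dC).
  by apply: cderiv_near h2; near=> z; rewrite thT.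
have h1 := cderivB (cderivM (shP _ _ 0 dth1) (shN _ _ 0 dth))
  (cderivM (shP _ _ 0 dth) (shN _ _ 0 dth1)).
have h2 := cderivD (cM (A u) _ _ 0 dA1) (cM (C u) _ _ 0 dC1).
have h3 := cderiv_near (f := fun v => th1 (u + v) * th (u - v) - th (u + v) * th1 (u - v)) _ h2.
have {h1 h2 h3} := cderiv_unique h1 (h3 _).
rewrite addr0 subr0 => E.
have {}E : 2 * thN th th1 th2 u = A u * A2 0 + C u * C2 0.
  by rewrite -E; [rewrite /thN; ring|near=> v; rewrite first].
by apply: (mulfI (_ : (2 : K) != 0)); rewrite ?pnatr_eq0// E; field.
Unshelve. all: by end_near. Qed.

(** * Complex logarithm *)

Section ComplexLogarithm.
Variable R : realType.
Local Notation C := R[i].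
Implicit Types (z w : C).

Lemma normrC (r : R) : `|r%:C| = `|r|%:C :> C.
Proof. by rewrite normc_def /= expr0n addr0 sqrtr_sqr. Qed.

Lemma ImB z w : complex.Im (z - w) = complex.Im z - complex.Im w.
Proof. by case: z w => [? ?] [? ?]. Qed.

Lemma cos_gt0_lt (t : R) : - pi < t <= pi -> 0 < cos t -> - (pi / 2) < t < pi / 2.
Proof.
move=> /andP[t1 t2] ct0; have p0 := pi_gt0 R.
apply/andP; split; rewrite ltNge; apply/negP => h.
  have := @cos_ge0_pihalf _ (t + pi); rewrite cosDpi.
  suff -> : - (pi / 2) <= t + pi <= pi / 2 by move=> /(_ isT); lra.
  by apply/andP; split; lra.
have := @cos_ge0_pihalf _ (t - pi); rewrite -[cos (t - pi)]opprK -cosDpi subrK.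
suff -> : - (pi / 2) <= t - pi <= pi / 2 by move=> /(_ isT); lra.
by apply/andP; split; lra.
Qed.

(** Closed form of the principal logarithm on the right half-plane, where the expectation lies for v
    near 0. *)
Definition clog_right z : C :=
  ln (Normc.normc z) +i* atan (complex.Im z / complex.Re z).

Lemma normc_gt0 z : 0 < complex.Re z -> 0 < Normc.normc z.
Proof. by move=> z0; apply: lt_le_trans z0 (Re_le_normc z). Qed.

Lemma cexp_clog_right z : 0 < complex.Re z -> cexp (clog_right z) = z.
Proof.
move=> z0; have n0 := normc_gt0 z0.
rewrite /cexp /clog_right /= lnK ?posrE//.
have [/andP[h1 h2] h3] := atan_def (complex.Im z / complex.Re z).
set t := atan _ in h1 h2 h3 *.
have c0 : 0 < cos t by apply: cos_gt0_pihalf; rewrite h1.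
have cs := cos2Dsin2 t.
have sE : sin t = complex.Im z / complex.Re z * cos t.
  by rewrite -h3 /tan divfK// gt_eqF.
have n2 : Normc.normc z ^+ 2 = complex.Re z ^+ 2 + complex.Im z ^+ 2.
  case: (z) => a b /=; by rewrite sqr_sqrtr// addr_ge0// sqr_ge0.
have nc : Normc.normc z * cos t = complex.Re z.
  have : (Normc.normc z * cos t) ^+ 2 = complex.Re z ^+ 2.
    rewrite exprMn n2; have z1 : complex.Re z != 0 by rewrite gt_eqF.
    transitivity (complex.Re z ^+ 2 * (cos t ^+ 2 + sin t ^+ 2)); last by rewrite cs mulr1.
    by rewrite sE; field.
  move=> /eqP; rewrite eqrXn2 ?ltW ?mulr_gt0// => /eqP; exact.
by apply/eqP; rewrite eq_complex /= nc eqxx /= sE mulrCA nc divfK ?eqxx ?gt_eqF.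
Qed.

(** Any logarithm w of z has cos(Im w) > 0; together with the bounds of the principal branch this
    puts Im w in ]-pi/2, pi/2[, where tan is injective. *)
Lemma clogE z : 0 < complex.Re z -> clog z = clog_right z.
Proof.
move=> z0; have n0 := normc_gt0 z0; have p0 := pi_gt0 R.
rewrite /clog; apply: xget_unique => /=.
  split; first exact: cexp_clog_right.
  have [/andP[h1 h2] _] := atan_def (complex.Im z / complex.Re z).
  by rewrite /clog_right /=; apply/andP; split; lra.
move=> w [wz wpi].
have ne : Normc.normc z = expR (complex.Re w).
  by apply: (@complexI R); rewrite -normcC -wz norm_cexp.
have ze : z = expR (complex.Re w) * cos (complex.Im w) +i* (expR (complex.Re w) * sin (complex.Im w)).
  by rewrite -wz.
have e0 := expR_gt0 (complex.Re w).
have c0 : 0 < cos (complex.Im w) by move: z0; rewrite ze /= pmulr_rgt0.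
apply/eqP; rewrite eq_complex /clog_right /= ne expRK eqxx /= ze /=.
rewrite (_ : _ / _ = tan (complex.Im w)); last by rewrite /tan; field; rewrite !gt_eqF.
by rewrite tanK// in_itv /= cos_gt0_lt.
Qed.

Lemma cts_clog z0 : 0 < complex.Re z0 -> cts (@clog R) z0.
Proof.
move=> rz0.
pose F := nbhs (z0 : C).
have hF (d : R) : 0 < d -> F [set z | Normc.normc (z - z0) < d].
  move=> d0; have d0' : 0 < d%:C :> C by rewrite ltcR.
  by have := near_dist z0 d0'; apply: filterS => z /=; rewrite normcC ltcR.
have cR : complex.Re z @[z --> F] --> complex.Re z0.
  apply/cvgrPdist_lt => eps /hF; apply: filterS => z /=; apply: le_lt_trans.
  by rewrite distrC -ReB -lecR -normcC normc_ge_Re.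
have cI : complex.Im z @[z --> F] --> complex.Im z0.
  apply/cvgrPdist_lt => eps /hF; apply: filterS => z /=; apply: le_lt_trans.
  by rewrite distrC -ImB -lecR -normcC normc_ge_Im.
have cN : Normc.normc z @[z --> F] --> Normc.normc z0.
  apply/cvgrPdist_lt => eps /hF; apply: filterS => z /=; apply: le_lt_trans.
  rewrite distrC -lecR -normcC -normrC rmorphB /= -!normcC.
  exact: ler_dist_dist.
have cL : ln (Normc.normc z) @[z --> F] --> ln (Normc.normc z0).
  by apply: continuous_cvg cN; apply: continuous_ln; exact: normc_gt0.
have cA : atan (complex.Im z / complex.Re z) @[z --> F] --> atan (complex.Im z0 / complex.Re z0).
  apply: continuous_cvg; first exact: continuous_atan.
  by apply: cvgM => //; apply: cvgV; rewrite ?gt_eqF.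
have r1 : F [set z | 0 < complex.Re z].
  by apply: (cvgr_gt (complex.Re z0) cR).
apply: (@cvgrPdist_lt C C C F _ (@clog R) (clog z0)).2 => eps.
rewrite ltcE /= => /andP[/eqP e1 e0].
have e20 : 0 < complex.Re eps / 2 by rewrite divr_gt0.
have hL := cvgr_dist_lt _ _ cL _ e20.
have hA := cvgr_dist_lt _ _ cA _ e20.
near=> z.
have z1 : 0 < complex.Re z by near: z.
have z2 : `|ln (Normc.normc z0) - ln (Normc.normc z)| < complex.Re eps / 2.
  by near: z; exact: hL.
have z3 : `|atan (complex.Im z0 / complex.Re z0) - atan (complex.Im z / complex.Re z)| <
   complex.Re eps / 2.
  by near: z; exact: hA.
rewrite !clogE//.
have -> : clog_right z0 - clog_right z = (ln (Normc.normc z0) - ln (Normc.normc z))%:C +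
    'i%C * (atan (complex.Im z0 / complex.Re z0) - atan (complex.Im z / complex.Re z))%:C.
  by rewrite [LHS]complexE.
apply: le_lt_trans (ler_normD _ _) _.
rewrite normrM !normcC /= !expr0n /= !expr1n !addr0 add0r !sqrtr_sqr sqrtr1 mul1r -rmorphD.
rewrite ltcE /= e1 eqxx /=; lra.
Unshelve. all: by end_near. Qed.

End ComplexLogarithm.

(** * Maximum modulus of doubly periodic functions *)

Section PeriodicMaximum.
Variable R : realType.
Local Notation C := R[i].

Lemma int_period (T : Type) (h : C -> T) w : (forall u, h (u + w) = h u) ->
  forall (n : int) u, h (u + n%:~R * w) = h u.
Proof.
move=> hw.
have nat_period (n : nat) u : h (u + n%:R * w) = h u.
  elim: n u => [|n IH] u; first by rewrite mul0r addr0.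
  by rewrite -natr1 mulrDl mul1r addrA hw IH.
move=> [n|n] u; first exact: nat_period.
have := nat_period n.+1 (u - n.+1%:R * w); rewrite subrK => ->.
by rewrite NegzE mulrNz mulNr.
Qed.

Lemma lattice_coords (B u : C) : 0 < complex.Re B ->
  exists x y : R, u = 'i%C * x%:C + B * y%:C.
Proof.
move=> B0; have [y e] : exists y, complex.Re B * y = complex.Re u.
  by exists (complex.Re u / complex.Re B); rewrite mulrC divfK// gt_eqF.
exists (complex.Im u - complex.Im B * y), y.
case: u B B0 e => [a b] [c d] /= _ e.
by apply/eqP; rewrite eq_complex /=; apply/andP; split; apply/eqP; rewrite -?e; ring.
Qed.

Lemma periodic_max (B : C) : 0 < complex.Re B -> forall h : C -> C,
  (forall x, cts h x) -> (forall u, h (u + 'i%C) = h u) -> (forall u, h (u + B) = h u) ->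
  exists u1, forall u, `|h u| <= `|h u1|.
Proof.
move=> B0 h hc hi hB.
pose U (p : R * R) : C := 'i%C * p.1%:C + B * p.2%:C.
pose f p := Normc.normc (h (U p)).
have nB : 0 < Normc.normc B + 1 by rewrite ltr_wpDl ?normc_ge0.
have fc p : {for p, continuous f}.
  suff : f q @[q --> p] --> f p by [].
  apply/cvgrPdist_lt => eps eps0.
  have eps0' : 0 < eps%:C :> C by rewrite ltcR.
  have [d d0 hd] := (cts_epsP h (U p)).1 (hc _) _ eps0'.
  (* In the partial order of the complex numbers a positive element is real. *)
  have [dr dE] : exists r : R, d = r%:C.
    by exists (complex.Re d); rewrite RRe_real// gtr0_real.
  have dr0 : 0 < dr by rewrite -ltcR -dE.
  (* Moving both coordinates by less than [del] moves the point by less than (1 + |B|) del = dr /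
     2. *)
  pose del := dr / (2 * (Normc.normc B + 1)).
  have del0 : 0 < del by rewrite divr_gt0// mulr_gt0.
  have c1 : (fun q : R * R => q.1) @ p --> p.1 by exact: cvg_fst.
  have c2 : (fun q : R * R => q.2) @ p --> p.2 by exact: cvg_snd.
  have n1 := cvgr_dist_lt _ _ c1 _ del0; have n2 := cvgr_dist_lt _ _ c2 _ del0.
  near=> q.
  have h1 : `|p.1 - q.1| < del by near: q; exact: n1.
  have h2 : `|p.2 - q.2| < del by near: q; exact: n2.
  rewrite /f -ltcR -normrC rmorphB /= -!normcC.
  apply: le_lt_trans (ler_dist_dist _ _) _; rewrite distrC; apply: hd.
  have -> : U q - U p = - ('i%C * (p.1 - q.1)%:C + B * (p.2 - q.2)%:C).
    by rewrite /U !rmorphB /=; ring.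
  rewrite normrN; apply: le_lt_trans (ler_normD _ _) _.
  have ni : `|'i%C| = 1 :> C by rewrite normc_def /= expr0n expr1n add0r sqrtr1.
  rewrite !normrM ni mul1r !normrC (normcC B) dE -rmorphM -rmorphD ltcR /=.
  have b0 := normc_ge0 B.
  have e1 : dr = 2 * (Normc.normc B * del) + 2 * del.
    by rewrite /del; field; rewrite gt_eqF.
  have e2 : Normc.normc B * `|p.2 - q.2| <= Normc.normc B * del.
    by rewrite ler_wpM2l// ltW.
  have e3 : 0 <= Normc.normc B * del by rewrite mulr_ge0// ltW.
  lra.
have cS : compact (`[0 : R, 1] `*` `[0 : R, 1])%classic.
  by apply: compact_setX; exact: segment_compact.
have S0 : ((`[0 : R, 1] `*` `[0 : R, 1]) !=set0)%classic.
  by exists (0, 0); split; rewrite /= in_itv /= lexx ler01.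
have [p _ hp] := compact_EVT_max S0 cS (continuous_subspaceT fc).
exists (U p) => u.
have [x [y ->]] := lattice_coords u B0.
pose q := (x - (Num.floor x)%:~R, y - (Num.floor y)%:~R).
have -> : h ('i%C * x%:C + B * y%:C) = h (U q).
  rewrite -(int_period hi (- Num.floor x)) -(int_period hB (- Num.floor y)).
  by congr h; rewrite /U /q /= !rmorphB /= !rmorph_int !rmorphN /=; ring.
rewrite !normcC lecR; apply: hp; apply/mem_set; rewrite /q.
have /andP[x1 x2] := floor_itv x; have /andP[y1 y2] := floor_itv y.
rewrite !rmorphD /= in x2 y2.
by split; rewrite /= in_itv /=; apply/andP; split; lra.
Unshelve. all: by end_near. Qed.

End PeriodicMaximum.

(** * Instantiation with the theta series, and the cumulants *)

Section ThetaEllipticFunction.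
Variables (R : realType) (B : R[i]) (B0 : 0 < complex.Re B).
Local Notation C := R[i].
Implicit Types (u v z : C).
Local Notation th := (fun u => theta u B).
Local Notation th1 := (dtheta B 1).
Local Notation th2 := (dtheta B 2).
Local Notation th3 := (dtheta B 3).

Lemma cderiv_theta (B' : C) u : 0 < complex.Re B' ->
  cderiv (fun z => theta z B') u (dtheta B' 1 u).
Proof.
move=> B'0; have := cderiv_dtheta u 0 B'0.
by rewrite (_ : dtheta B' 0 = fun z => theta z B')//; apply/funext => z; rewrite dtheta0.
Qed.

Let B20 := Re2B_gt0 B0.

Let tpi : C := 2 * pi%:C.

Lemma tpi_neq0 : tpi != 0.
Proof.
by rewrite mulf_neq0 ?pnatr_eq0// eq_complex /= negb_and gt_eqF ?pi_gt0.
Qed.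

Let A1 u := dtheta (2 * B) 1 (2 * u) * 2.
Let A2 u := dtheta (2 * B) 2 (2 * u) * 2 * 2.

Let daff (f : C -> C) (f' : C -> C) (c : C) u : (forall z, cderiv f z (f' z)) ->
  cderiv (fun z => f (2 * z - c)) u (f' (2 * u - c) * 2).
Proof. by move=> df; apply: cderiv_affine; exact: df. Qed.

Let daff0 (f : C -> C) (f' : C -> C) u : (forall z, cderiv f z (f' z)) ->
  cderiv (fun z => f (2 * z)) u (f' (2 * u) * 2).
Proof.
move=> df; have := daff 0 u df; rewrite subr0; apply: cderiv_near.
by near=> z; rewrite subr0.
Unshelve. all: by end_near. Qed.

Let dA u : cderiv (thetaA B) u (A1 u).
Proof. by apply: (daff0 (f := fun z => theta z (2 * B))) => z; exact: cderiv_theta. Qed.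

Let dA1 u : cderiv A1 u (A2 u).
Proof.
have h := daff0 u (fun z => cderiv_dtheta z 1 B20).
by have := cderivM h (cderiv_cst (2 : C) u); rewrite mulr0 addr0.
Qed.

Let E z := e2pi (z - B / 4) : C.
Let dE u : cderiv E u (tpi * E u).
Proof. exact: (cderiv_shift (cderiv_e2pi (u + - (B / 4)))). Qed.

Let H u := theta (2 * u - B) (2 * B).
Let H1 u := dtheta (2 * B) 1 (2 * u - B) * 2.
Let H2 u := dtheta (2 * B) 2 (2 * u - B) * 2 * 2.
Let dH u : cderiv H u (H1 u).
Proof. by apply: (daff (f := fun z => theta z (2 * B))) => z; exact: cderiv_theta. Qed.
Let dH1 u : cderiv H1 u (H2 u).
Proof.
have h := daff B u (fun z => cderiv_dtheta z 1 B20).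
by have := cderivM h (cderiv_cst (2 : C) u); rewrite mulr0 addr0.
Qed.

Let C1 u := tpi * E u * H u + E u * H1 u.
(** The summand [0 * E u] is the derivative of the constant [tpi], as the product rule leaves it. *)
Let C2 u := (0 * E u + tpi * (tpi * E u)) * H u + tpi * E u * H1 u +
  (tpi * E u * H1 u + E u * H2 u).
Let dC u : cderiv (thetaC B) u (C1 u).
Proof. exact: cderivM. Qed.
Let dC1 u : cderiv C1 u (C2 u).
Proof.
exact: (cderivD (cderivM (cderivM (cderiv_cst tpi u) (dE u)) (dH u)) (cderivM (dE u) (dH1 u))).
Qed.

Let dth u : cderiv th u (th1 u) := cderiv_theta u B0.
Let dth1 u : cderiv th1 u (th2 u) := cderiv_dtheta u 1 B0.
Let dth2 u : cderiv th2 u (th3 u) := cderiv_dtheta u 2 B0.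

Let thT u v : th (u + v) * th (u - v) = thetaA B u * thetaA B v + thetaC B u * thetaC B v
  := theta_addition B0 u v.

Let al := A2 0 / 2.
Let ga := C2 0 / 2.

Definition thetaN u := thN th th1 th2 u.
Definition thetaM u := thM th th1 th2 th3 u.

Let thNE u : thN th th1 th2 u = al * thetaA B u + ga * thetaC B u.
Proof. exact: (thN_bilinear dth dth1 dA dA1 dC dC1 thT). Qed.

Let w1 : C := 'i%C / 2.
Let w2 : C := B / 2.
Let two_w1 : 2 * w1 = 'i%C. Proof. by rewrite /w1; field. Qed.
Let two_w2 : 2 * w2 = B. Proof. by rewrite /w2; field. Qed.

Let eD := @e2piD R.
Let e_neq0 := @e2pi_neq0 R.
Let ew1 : e2pi w1 = -1 := e2pi_half_i R.
Let de := @cderiv_e2pi R.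
Let th_even u : th (- u) = th u := theta_even B0 u.
Let th_w1 u : th (u + 2 * w1) = th u.
Proof. by rewrite two_w1; exact: theta_period. Qed.
Let th_w2 u : th (u + 2 * w2) = e2pi (w2 + u) * th u.
Proof. by rewrite two_w2; exact: theta_quasi_period. Qed.
Let th_w1w2 : th (w1 + w2) = 0 := theta_zero B0.
Let A_w1 u : thetaA B (u + w1) = thetaA B u := thetaA_half_i B u.
Let C_w1 u : thetaC B (u + w1) = - thetaC B u := thetaC_half_i B u.
Let A_w2 u : thetaA B (u + w2) = e2pi (w2 / 2 + u) * thetaC B u.
Proof. by rewrite thetaA_half_B//; congr (e2pi _ * _); rewrite /w2; field. Qed.
Let C_w2 u : thetaC B (u + w2) = e2pi (w2 / 2 + u) * thetaA B u.
Proof. by rewrite thetaC_half_B//; congr (e2pi _ * _); rewrite /w2; field. Qed.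
Let A_even u : thetaA B (- u) = thetaA B u.
Proof. by rewrite /thetaA mulrN theta_even. Qed.
Let C_even u : thetaC B (- u) = thetaC B u := thetaC_even B0 u.
Let A_cont u : cts (thetaA B) u := cderiv_continuous (dA u).
Let C_cont u : cts (thetaC B) u := cderiv_continuous (dC u).
Let th3_cont u : cts th3 u := cderiv_continuous (cderiv_dtheta u 3 B0).
Let th_ord p := theta_order p B0 (theta_neq0 B0).

Lemma theta1_neq0 u : theta u B = 0 -> th1 u != 0.
Proof.
exact: (@th1_neq0 _ (@e2pi R) th th1 (thetaA B) (thetaC B) w1 w2 tpi eD e_neq0 ew1 de
  th_even thT A_w1 C_w1 A_w2 C_w2 A_cont C_cont dth th_ord u).
Qed.

Lemma thetaN_surj y : exists u, thetaN u = y * theta u B ^+ 2.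
Proof.
apply: (@thN_surj _ (@e2pi R) th th1 th2 th3 (thetaA B) (thetaC B) w1 w2 tpi al ga eD
  e_neq0 ew1 de th_even th_w1 th_w2 th_w1w2 thT A_w1 C_w1 A_w2 C_w2 A_cont C_cont dth dth1
  dth2 th_ord thNE).
by rewrite two_w1 two_w2; exact: periodic_max.
Qed.

Lemma theta_cubic u : thetaM u ^+ 2 = -4 * (thetaN u - thetaN 0 / theta 0 B ^+ 2 * theta u B ^+ 2) *
  (thetaN u - thetaN w1 / theta w1 B ^+ 2 * theta u B ^+ 2) *
  (thetaN u - thetaN w2 / theta w2 B ^+ 2 * theta u B ^+ 2).
Proof.
exact: (@thM_cubic _ (@e2pi R) th th1 th2 th3 (thetaA B) (thetaC B) w1 w2 tpi al ga eD
  e_neq0 ew1 de th_even th_w1 th_w2 th_w1w2 thT A_w1 C_w1 A_w2 C_w2 C_even A_cont C_cont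
  dth dth1 dth2 th3_cont th_ord thNE u).
Qed.

Lemma thetaN_even u : thetaN (- u) = thetaN u.
Proof. exact: (thN_even A_even C_even thNE). Qed.

Lemma thetaN_period u : thetaN (u + 'i%C) = thetaN u.
Proof. by rewrite -two_w1; exact: (thN_w1 A_w1 C_w1 thNE). Qed.

Lemma thetaN_quasi_period u : thetaN (u + B) = e2pi (B / 2 + u) ^+ 2 * thetaN u.
Proof. by rewrite -{1}two_w2; exact: (thN_w2 eD A_w2 C_w2 thNE). Qed.

Lemma thetaM_odd u : thetaM (- u) = - thetaM u.
Proof. exact: (thM_odd th_even A_even C_even dth dth1 dth2 thNE). Qed.

Lemma thetaM_period u : thetaM (u + 'i%C) = thetaM u.
Proof. by rewrite -two_w1; exact: (thM_w1 th_w1 A_w1 C_w1 dth dth1 dth2 thNE). Qed.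

Lemma thetaM_quasi_period u : thetaM (u + B) = e2pi (B / 2 + u) ^+ 3 * thetaM u.
Proof. by rewrite -{1}two_w2; exact: (thM_w2 eD de th_w2 A_w2 C_w2 dth dth1 dth2 thNE). Qed.

Lemma thetaN_continuous u : cts thetaN u.
Proof. exact: (thN_cont dth dth1 dth2). Qed.

Lemma thetaM_continuous u : cts thetaM u.
Proof. exact: (thM_cont dth dth1 dth2 th3_cont). Qed.

Lemma theta_continuous u : cts th u.
Proof. exact: cderiv_continuous (dth u). Qed.

Lemma theta_nonzero_near u : \forall s \near 0, s != 0 -> theta (u + s) B != 0.
Proof. exact: (@th_nonzero_near _ th th_ord u). Qed.

(** Weighting by e^(vn) shifts u by v / (2 pi), so near v = 0 the cumulants are derivatives of log
    theta up to powers of 2 pi. *)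
Lemma gauss_expectation_cexp u v : gauss_expectation u B (fun n => cexp (v * n%:~R)) =
  (theta u B)^-1 * theta (tpi^-1 * v + u) B.
Proof.
rewrite /gauss_expectation (_ : (fun n => _) =
    (fun n => (theta u B)^-1 * theta_term (tpi^-1 * v + u) B n)).
  by apply: sum_has_sum; apply: has_sumMl; exact: theta_has_sum.
apply/funext => n; rewrite /ptheta [tpi^-1 * v + u]addrC theta_termD.
have -> : v * n%:~R = freq R n * (tpi^-1 * v) by rewrite /freq -/tpi; field; exact: tpi_neq0.
by rewrite mulrCA [X in _ * X]mulrC.
Qed.

Let daff' (f : C -> C) (a : C) u v : cderiv f (tpi^-1 * v + u) a ->
  cderiv (fun z => f (tpi^-1 * z + u)) v (a / tpi).
Proof. exact: cderiv_affine. Qed.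

Let Q1 u := th1 u / theta u B.
Let Q2 u := thetaN u / theta u B ^+ 2.
Let Q3 u := thetaM u / theta u B ^+ 3.

Let dQ1 u : theta u B != 0 -> cderiv Q1 u (Q2 u).
Proof.
exact: (@cderiv_dlog _ th th1 th2 dth dth1 u).
Qed.

Let dQ2 u : theta u B != 0 -> cderiv Q2 u (Q3 u).
Proof. exact: (@cderiv_d2log _ th th1 th2 th3 dth dth1 dth2 u). Qed.

Let L u v := clog (gauss_expectation u B (fun n => cexp (v * n%:~R))).
Let F u v := (theta u B)^-1 * theta (tpi^-1 * v + u) B.

Let dF u v : cderiv (F u) v ((theta u B)^-1 * (th1 (tpi^-1 * v + u) / tpi)).
Proof.
have h := cderivM (cderiv_cst (theta u B)^-1 v) (daff' (dth (tpi^-1 * v + u))).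
by rewrite mul0r add0r in h.
Qed.

Let F0 u : theta u B != 0 -> F u 0 = 1.
Proof. by move=> t0; rewrite /F mulr0 add0r mulVf. Qed.

Let F_right u : theta u B != 0 -> \forall v \near 0, 0 < complex.Re (F u v).
Proof.
move=> t0; have h : \forall v \near 0, `|F u 0 - F u v| < 1.
  have Fc := cderiv_continuous (dF u 0).
  exact: (cvgr_dist_lt (F u) (F u 0) Fc _ ltr01).
apply: filterS h => v; rewrite F0// => h.
have := normc_ge_Re (1 - F u v); rewrite ReB => h2.
have : `|1 - complex.Re (F u v)|%:C < 1 :> C by exact: le_lt_trans h2 h.
by rewrite -[1 : C]/(1%:C) ltcR ltr_distlC => /andP[+ _]; rewrite subrr.
Qed.

Let F_neq0 u v : 0 < complex.Re (F u v) -> theta (tpi^-1 * v + u) B != 0.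
Proof. by apply: contraTneq => h; rewrite /F h mulr0 ltxx. Qed.

Let LE u : L u = fun v => clog (F u v).
Proof. by apply/funext => v; rewrite /L gauss_expectation_cexp. Qed.

(** Stated for all v near 0 because the second derivative needs the first on a neighbourhood;
    [near_join] provides a neighbourhood of each such v on which the expectation has positive real
    part. *)
Let dL u : theta u B != 0 -> \forall v \near 0, cderiv (L u) v (Q1 (tpi^-1 * v + u) / tpi).
Proof.
move=> t0; have := near_join (F_right t0); apply: filterS => v hv.
have rv : 0 < complex.Re (F u v) := nbhs_singleton hv.
have th0 := F_neq0 rv.
have eL z : 0 < complex.Re (F u z) -> cexp (L u z) = F u z.
  by move=> rz; rewrite LE clogE// cexp_clog_right.
have Lc : cts (L u) v.
  rewrite LE; apply: cts_comp; first exact: cderiv_continuous (dF u v).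
  exact: cts_clog.
have Fv0 : F u v != 0 by rewrite mulf_neq0 ?invr_eq0.
have eLn : \forall z \near v, cexp (L u z) = F u z by apply: filterS hv => z; exact: eL.
have de' : cderiv (@cexp R) (L u v) (F u v) by rewrite -(eL v rv); exact: cderiv_cexp.
have := cderiv_inv Lc Fv0 eLn (dF u v) de'.
rewrite (_ : _ / F u v = Q1 (tpi^-1 * v + u) / tpi)//.
by rewrite /F /Q1; field; rewrite t0 th0 tpi_neq0.
Qed.

Let near_F_neq0 u : theta u B != 0 -> \forall v \near 0, theta (tpi^-1 * v + u) B != 0.
Proof. by move=> /F_right; apply: filterS => v; exact: F_neq0. Qed.

Let dL2 u : theta u B != 0 ->
  \forall v \near 0, cderiv (derive1 (L u)) v (Q2 (tpi^-1 * v + u) / tpi ^+ 2).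
Proof.
move=> t0; near=> v.
have h1 : \forall z \near v, derive1 (L u) z = Q1 (tpi^-1 * z + u) * tpi^-1.
  have : \forall z \near v, cderiv (L u) z (Q1 (tpi^-1 * z + u) / tpi).
    by near: v; apply: near_join; exact: dL.
  by apply: filterS => z; exact: derive1_cderivC.
have th0 : theta (tpi^-1 * v + u) B != 0 by near: v; exact: near_F_neq0.
have h2 := cderivM (daff' (dQ1 th0)) (cderiv_cst (tpi^-1) v).
rewrite mulr0 addr0 -mulrA -invfM -expr2 in h2.
exact: cderiv_near h1 h2.
Unshelve. all: by end_near. Qed.

Let dL3 u : theta u B != 0 ->
  cderiv (derive1 (derive1 (L u))) 0 (Q3 u / tpi ^+ 3).
Proof.
move=> t0.
have h1 : \forall z \near 0, derive1 (derive1 (L u)) z = Q2 (tpi^-1 * z + u) * tpi^-2.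
  have := dL2 t0; apply: filterS => z; exact: derive1_cderivC.
have p0 : tpi^-1 * 0 + u = u by rewrite mulr0 add0r.
have dq : cderiv Q2 (tpi^-1 * 0 + u) (Q3 u) by rewrite p0; exact: dQ2.
have h2 := cderivM (daff' dq) (cderiv_cst (tpi^-2) 0).
rewrite mulr0 addr0 -mulrA -invfM -exprS in h2.
exact: cderiv_near h1 h2.
Qed.

Lemma cumulant2 u : theta u B != 0 ->
  cumulant 2 u B = thetaN u / theta u B ^+ 2 / (2 * pi%:C) ^+ 2.
Proof.
move=> t0; have h := nbhs_singleton (dL2 t0); rewrite mulr0 add0r in h.
exact: (derive1_cderivC h).
Qed.

Lemma cumulant3 u : theta u B != 0 ->
  cumulant 3 u B = thetaM u / theta u B ^+ 3 / (2 * pi%:C) ^+ 3.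
Proof. by move=> t0; exact: (derive1_cderivC (dL3 t0)). Qed.

Lemma derive1_theta u : derive1 (fun w => theta w B) u = th1 u.
Proof. exact: derive1_cderivC (dth u). Qed.

Lemma D2log_thetaE u : D2log_theta u B = thetaN u / theta u B ^+ 2.
Proof.
have E1 : derive1 (fun w => theta w B) = th1.
  by apply/funext => w; exact: derive1_theta.
have E2 : derive1 th1 u = th2 u by exact: derive1_cderivC (dth1 u).
by rewrite /D2log_theta /derive1n /= E1 E2.
Qed.

End ThetaEllipticFunction.

(** [A] accumulates at [u], so the restricted filter is proper and its limit is unique. *)
Lemma lim_within (K : numFieldType) (A : set K) (f g : K -> K) u :
  (forall w, A w -> f w = g w) -> cts g u ->
  (\forall s \near 0, s != 0 -> A (u + s)) -> lim (f @ within A (nbhs u)) = g u.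
Proof.
move=> fg gc nA.
have cl : closure A u.
  move=> P /nbhs0P hP.
  have [s [s0 [As Ps]]] : exists s, s != 0 /\ A (u + s) /\ P (u + s).
    apply: near0_ex; near=> s => s0; split; last by near: s.
    by move: s0; near: s.
  by exists (u + s).
have FP : ProperFilter (within A (nbhs u)) := within_nbhs_proper cl.
apply: norm_cvg_lim; apply: (@near_cvg_eq _ _ _ f g (g u)).
  by near=> w; apply: fg; near: w; exact: withinT.
by apply: cvg_trans gc; apply: cvg_app; exact: cvg_within.
Unshelve. all: by end_near. Qed.

(** * The cubic *)

Section CubicModel.
Variables (R : realType) (B : R[i]) (B0 : 0 < complex.Re B).
Local Notation C := R[i].
Local Notation tN := (thetaN B).
Local Notation tM := (thetaM B).
Local Notation p := (pi%:C : C).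

Lemma piC_neq0 : p != 0.
Proof. by rewrite eq_complex /= negb_and gt_eqF ?pi_gt0. Qed.

(** The coordinates theta^3, theta^3 kappa_2 and theta^3 kappa_3 with their denominators cleared,
    hence continuous across the zeros of theta. *)
Definition embedding u : 'rV[C]_3 :=
  \row_j [:: theta u B ^+ 3; theta u B * tN u / (2 * p) ^+ 2; tM u / (2 * p) ^+ 3]`_j.

Let lim_theta (f : C -> C) (g : C -> C) u :
  (forall w, theta w B != 0 -> f w = g w) -> cts g u ->
  lim (f @ within (~` Theta B) (nbhs u)) = g u.
Proof.
move=> fg gc; apply: lim_within => //.
  by move=> w /eqP; exact: fg.
by have := theta_nonzero_near B0 u; apply: filterS => s h /h/eqP.
Qed.

Lemma theta3_cumulantE j (g : C -> C) u :
  (forall w, theta w B != 0 -> theta w B ^+ 3 * cumulant j w B = g w) -> cts g u ->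
  theta3_cumulant j B u = g u.
Proof.
move=> fg gc; rewrite /theta3_cumulant.
case: (boolP (theta u B != 0)) => t0.
  exact: fg.
exact: lim_theta.
Qed.

Lemma phi3_coordE u : phi3_coord B u = embedding u.
Proof.
have e2 w : theta w B != 0 ->
    theta w B ^+ 3 * cumulant 2 w B = theta w B * tN w / (2 * p) ^+ 2.
  move=> t0; rewrite cumulant2//; move: (2 * p) (tpi_neq0 R) => q q0.
  by field; rewrite q0 t0.
have e3 w : theta w B != 0 -> theta w B ^+ 3 * cumulant 3 w B = tM w / (2 * p) ^+ 3.
  move=> t0; rewrite cumulant3//; move: (2 * p) (tpi_neq0 R) => q q0.
  by field; rewrite q0 t0.
suff [E2 E3] : theta3_cumulant 2 B u = theta u B * tN u / (2 * p) ^+ 2 /\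
  theta3_cumulant 3 B u = tM u / (2 * p) ^+ 3 by rewrite /phi3_coord E2 E3.
split.
  apply: (@theta3_cumulantE 2 (fun u => theta u B * tN u / (2 * p) ^+ 2)) => [w|].
    exact: e2.
  have h := ctsM (@theta_continuous R B B0 u) (@thetaN_continuous R B B0 u).
  exact: (@ctsM C _ (fun=> ((2 * p) ^+ 2)^-1) u h (@cts_cst C _ u)).
apply: (@theta3_cumulantE 3 (fun u => tM u / (2 * p) ^+ 3)) => [w|].
  exact: e3.
exact: (@ctsM C _ (fun=> ((2 * p) ^+ 3)^-1) u (@thetaM_continuous R B B0 u) (@cts_cst C _ u)).
Qed.

Lemma embeddingE u : [/\ embedding u 0 0 = theta u B ^+ 3,
  embedding u 0 1 = theta u B * tN u / (2 * p) ^+ 2 &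
  embedding u 0 2 = tM u / (2 * p) ^+ 3].
Proof. by split; rewrite mxE. Qed.

Lemma row3_eq (X Y : 'rV[C]_3) : X 0 0 = Y 0 0 -> X 0 1 = Y 0 1 -> X 0 2 = Y 0 2 -> X = Y.
Proof.
move=> h0 h1 h2; apply/rowP => -[[|[|[|//]]] hj].
- by rewrite (_ : Ordinal hj = 0)//; exact: val_inj.
- by rewrite (_ : Ordinal hj = 1)//; exact: val_inj.
- by rewrite (_ : Ordinal hj = 2)//; exact: val_inj.
Qed.

Lemma embedding_period u : embedding (u + 'i%C) = embedding u.
Proof.
have [h0 h1 h2] := embeddingE u; have [k0 k1 k2] := embeddingE (u + 'i%C).
apply: row3_eq.
- by rewrite h0 k0 theta_period.
- by rewrite h1 k1 theta_period (thetaN_period B0).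
- by rewrite h2 k2 (thetaM_period B0).
Qed.

Lemma embedding_quasi_period u :
  embedding (u + B) = e2pi (B / 2 + u) ^+ 3 *: embedding u.
Proof.
have [h0 h1 h2] := embeddingE u; have [k0 k1 k2] := embeddingE (u + B).
have tq := theta_quasi_period B0 u; have nq := thetaN_quasi_period B0 u.
have mq := thetaM_quasi_period B0 u.
apply: row3_eq; rewrite [RHS]mxE.
- by rewrite h0 k0 tq exprMn.
- by rewrite h1 k1 tq nq; ring.
- by rewrite h2 k2 mq mulrA.
Qed.

Lemma thetaM_zero u : theta u B = 0 -> tM u = 2 * dtheta B 1 u ^+ 3.
Proof. by rewrite /thetaM /thM => ->; ring. Qed.

(** Where theta vanishes, M = 2 theta'^3 is nonzero because the zeros are simple. *)
Lemma embedding_neq0 u : embedding u != 0.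
Proof.
have [h0 h1 h2] := embeddingE u.
apply/eqP => e.
have z0 : theta u B ^+ 3 = 0 by rewrite -h0 e mxE.
have z2 : tM u / (2 * p) ^+ 3 = 0 by rewrite -h2 e mxE.
have t0 : theta u B = 0 by move/eqP: z0; rewrite expf_eq0 => /andP[_ /eqP].
have t1 := theta1_neq0 B0 t0.
have : tM u / (2 * p) ^+ 3 != 0.
  by rewrite (thetaM_zero t0) !mulf_neq0 ?invr_eq0 ?expf_neq0 ?tpi_neq0 ?pnatr_eq0.
by rewrite z2 eqxx.
Qed.

Lemma vlineZ (X : 'rV[C]_3) k : k != 0 -> <[k *: X]>%VS = <[X]>%VS.
Proof.
move=> k0; apply/eqP; rewrite eqEsubv -!memvE; apply/andP; split.
  by apply/vlineP; exists k.
by apply/vlineP; exists k^-1; rewrite scalerA mulVf// scale1r.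
Qed.

(** All three coordinates have the same automorphy factor, so translation by a period does not
    change the line. *)
Lemma embedding_lattice u v : (u - v) \in period_lattice B ->
  <[embedding u]>%VS = <[embedding v]>%VS.
Proof.
move=> /asboolP[m [n h]].
pose line w := <[embedding w]>%VS.
have hi (w : C) : line (w + 'i%C) = line w by rewrite /line embedding_period.
have hB (w : C) : line (w + B) = line w.
  by rewrite /line embedding_quasi_period vlineZ// expf_neq0// e2pi_neq0.
rewrite -[RHS]/(line v) -(int_period hi m v) -(int_period hB n) -[LHS]/(line u).
by congr line; rewrite -(subrK v u) h; ring.
Qed.

Lemma cubic_scale (k : C) (X : 'rV[C]_3) : cubic_eq B X -> cubic_eq B (k *: X).
Proof.
rewrite /cubic_eq !mxE => h.
transitivity (k ^+ 3 * (X 0 0 * X 0 2 ^+ 2)); first by ring.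
by rewrite h; ring.
Qed.

Lemma thetaM_sqr u : tM u ^+ 2 = -4 * (tN u - e1 B * theta u B ^+ 2) *
  (tN u - e2 B * theta u B ^+ 2) * (tN u - e3 B * theta u B ^+ 2).
Proof. by rewrite /e1 /e2 /e3 !D2log_thetaE// theta_cubic. Qed.

Lemma embedding_cubic u : cubic_eq B (embedding u).
Proof.
have [h0 h1 h2] := embeddingE u; rewrite /cubic_eq h0 h1 h2.
have p0 := piC_neq0.
have -> : (tM u / (2 * p) ^+ 3) ^+ 2 = tM u ^+ 2 / (2 * p) ^+ 6.
  by rewrite expr_div_n -exprM.
rewrite thetaM_sqr /coef_a /coef_b /coef_c.
move: (e1 B) (e2 B) (e3 B) (theta u B) (tN u) p p0 => x y z t n q q0.
by field; rewrite q0.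
Qed.

Lemma cumulant_cubic u : theta u B != 0 -> cumulant 3 u B ^+ 2 =
  - 4 * cumulant 2 u B ^+ 3 + coef_a B * cumulant 2 u B ^+ 2
  + coef_b B * cumulant 2 u B + coef_c B.
Proof.
move=> t0; have p0 := piC_neq0; rewrite cumulant2// cumulant3//.
have -> : (tM u / theta u B ^+ 3 / (2 * p) ^+ 3) ^+ 2 =
    tM u ^+ 2 / (theta u B ^+ 6 * (2 * p) ^+ 6).
  by rewrite !expr_div_n -!exprM -mulrA -invfM.
rewrite thetaM_sqr /coef_a /coef_b /coef_c.
move: (e1 B) (e2 B) (e3 B) (theta u B) t0 (tN u) p p0 => x y z t t0 n q q0.
by field; rewrite q0 t0.
Qed.

(** If X_0 = 0 the equation forces X_1 = 0, and the one remaining point [0, 0, 1] is the image of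
    the zero u0. Otherwise u is chosen with kappa_2 = X_1 / X_0, and the equation determines kappa_3
    up to sign. *)
Lemma embedding_surj (X : 'rV[C]_3) : X != 0 -> cubic_eq B X ->
  exists u, exists2 k, k != 0 & embedding u = k *: X.
Proof.
move=> X0; rewrite /cubic_eq; have p0 := piC_neq0.
have tp0 : 2 * p != 0 by rewrite mulf_neq0 ?pnatr_eq0.
have [x0|x0] := eqVneq (X 0 0) 0.
  rewrite x0 => h.
  have : - 4 * X 0 1 ^+ 3 = 0.
    transitivity (- 4 * X 0 1 ^+ 3 + coef_a B * 0 * X 0 1 ^+ 2 + coef_b B * 0 ^+ 2 * X 0 1 +
      coef_c B * 0 ^+ 3); first by ring.
    by rewrite -h mul0r.
  move/eqP; rewrite mulf_eq0 oppr_eq0 pnatr_eq0 expf_eq0 /= => /eqP x1.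
  have x2 : X 0 2 != 0.
    apply: contra X0 => /eqP x2; apply/eqP; apply: row3_eq; by rewrite mxE.
  exists ('i%C / 2 + B / 2); have t0 := theta_zero B0.
  have t1 := theta1_neq0 B0 t0.
  have [h0 h1 h2] := embeddingE ('i%C / 2 + B / 2).
  rewrite t0 expr0n mul0r mul0r in h0 h1.
  have m0 : tM ('i%C / 2 + B / 2) != 0.
    by rewrite (thetaM_zero t0) mulf_neq0 ?pnatr_eq0 ?expf_neq0.
  exists (tM ('i%C / 2 + B / 2) / (2 * p) ^+ 3 / X 0 2).
    by rewrite !mulf_neq0 ?invr_eq0 ?expf_neq0.
  apply: row3_eq; rewrite [RHS]mxE ?h0 ?h1 ?h2 ?x0 ?x1 ?mulr0//.
  by rewrite divfK.
move=> hX.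
have [u hu] := thetaN_surj B0 (X 0 1 / X 0 0 * (2 * p) ^+ 2).
(* At a zero of theta, [hu] would give N = 0, but there N = -theta'^2 is nonzero. *)
have t0 : theta u B != 0.
  apply/eqP => t0; have := theta1_neq0 B0 t0; move/eqP: hu.
  rewrite /thetaN /thN t0 expr0n /= mulr0 mul0r sub0r oppr_eq0 expf_eq0 /=.
  by move=> ->.
have [h0 h1 h2] := embeddingE u; have := embedding_cubic u.
rewrite /cubic_eq h0 h1 hu.
(* [r] is kappa_3 at [u]. *)
pose r := embedding u 0 2 / theta u B ^+ 3.
have -> : embedding u 0 2 = r * theta u B ^+ 3 by rewrite /r divfK// expf_neq0.
move=> hE.
have r2 : r ^+ 2 = (X 0 2 / X 0 0) ^+ 2.
  have t9 : theta u B ^+ 9 != 0 by rewrite expf_neq0.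
  apply: (mulfI t9); transitivity (theta u B ^+ 3 * (r * theta u B ^+ 3) ^+ 2).
    by ring.
  rewrite hE.
  have -> : (X 0 2 / X 0 0) ^+ 2 = X 0 0 * X 0 2 ^+ 2 / X 0 0 ^+ 3 by field.
  rewrite hX; move: (coef_a B) (coef_b B) (coef_c B) (theta u B) t0 (X 0 1) (X 0 0) x0 => a b c t t0 y x x0.
  by move: p tp0 p0 => q tp0 p0; field; rewrite x0 p0.
have fin w : theta w B = theta u B -> tN w = tN u ->
    embedding w 0 2 = X 0 2 / X 0 0 * theta u B ^+ 3 ->
    exists2 k, k != 0 & embedding w = k *: X.
  move=> ew1 ew2 ew3; exists (theta u B ^+ 3 / X 0 0).
    by rewrite mulf_neq0 ?expf_neq0 ?invr_eq0.
  have [k0 k1 k2] := embeddingE w.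
  apply: row3_eq; rewrite [RHS]mxE.
  - by rewrite k0 ew1 divfK.
  - by rewrite k1 ew1 ew2 hu; move: (2 * p) tp0 => q q0; field; rewrite x0 q0.
  - by rewrite ew3; field.
have /orP[/eqP rE|/eqP rE] : (r == X 0 2 / X 0 0) || (r == - (X 0 2 / X 0 0)).
    by rewrite -eqf_sqr r2.
  by exists u; apply: fin => //; rewrite -rE /r divfK// expf_neq0.
exists (- u); apply: fin; [exact: theta_even|exact: thetaN_even|].
have [_ _ ->] := embeddingE (- u); rewrite thetaM_odd// mulNr -h2.
have -> : embedding u 0 2 = r * theta u B ^+ 3 by rewrite /r divfK// expf_neq0.
by rewrite rE mulNr opprK.
Qed.

Lemma embedding_dim u : \dim <[embedding u]> == 1%N.
Proof. by rewrite dim_vline embedding_neq0. Qed.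

(** Evaluated at the canonical representative; by [embedding_lattice] the line does not depend on
    that choice. *)
Definition phi3 (x : elliptic_curve B) : P2 R :=
  exist _ <[embedding (repr x)]>%VS (embedding_dim (repr x)).

Lemma line_phi3 x : line_of (phi3 x) = <[embedding (repr x)]>%VS.
Proof. by []. Qed.

Lemma phi3P : is_phi3 phi3.
Proof.
move=> u; rewrite phi3_coordE line_phi3; apply: embedding_lattice.
by rewrite Quotient.idealrBE reprK.
Qed.

Lemma range_phi3 : range phi3 = cubic B.
Proof.
apply/seteqP; split=> [_ [x _ <-] X|q hq] /=.
  rewrite line_phi3 => /vlineP[k ->].
  by apply: cubic_scale; exact: embedding_cubic.
pose L := line_of q; have L1 : \dim L == 1%N := valP q.
pose X := vpick L.
have X0 : X != 0.
  by rewrite vpick0 -dimv_eq0 (eqP L1).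
have LX : <[X]>%VS = L.
  by apply/eqP; rewrite eqEdim -memvE memv_pick dim_vline X0 (eqP L1).
have [u [k k0 hk]] := embedding_surj X0 (hq X (memv_pick L)).
exists (\pi_(elliptic_curve B)%qT u) => //; apply: val_inj.
by have := phi3P u; rewrite phi3_coordE hk vlineZ// LX.
Qed.

End CubicModel.

Theorem proposition5p10 (R : realType) (B : R[i]) (hB : 0 < complex.Re B) :
  (exists2 phi : elliptic_curve B -> P2 R,
     is_phi3 phi & range phi = cubic B) /\
  (forall u : R[i], theta u B != 0 ->
     cumulant 3 u B ^+ 2 =
       - 4 * cumulant 2 u B ^+ 3 + coef_a B * cumulant 2 u B ^+ 2
       + coef_b B * cumulant 2 u B + coef_c B).
Proof.
split; last exact: cumulant_cubic.
by exists (phi3 hB); [exact: phi3P|exact: range_phi3].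
Qed.
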